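(* Let $\Omega$ be a simply connected domain in $\mathbb{R}^2$. If $\Omega\neq\mathbb{R}^2$, then there is a one-to-one conformal mapping \[ \varphi:\Omega\rightarrow D \] of the domain $\Omega$ onto the unit disk $D=\{\vec{x}\in\mathbb{R}^2:\ |\vec{x}|<1\}$.
   Context: A continuously differentiable one-to-one mapping $\varphi:\Omega_1\rightarrow\Omega_2$ of a domain $\Omega_1\subset\mathbb{R}^2$ onto a domain $\Omega_2\subset\mathbb{R}^2$ is called conformal if for each point $\vec{x}\in\Omega_1$ there is a number $M(\vec{x})$ such that \[ |\varphi(\vec{x}+\Delta\vec{x})-\varphi(\vec{x})|=M(\vec{x})|\Delta\vec{x}|+o(|\Delta\vec{x}|)\quad\text{as }\Delta\vec{x}\to 0. \] A domain is a nonempty connected open set. *)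

(* Defs.v *)
From HB Require Import structures.
From mathcomp Require Import all_boot all_order all_algebra.
From mathcomp Require Import all_classical all_reals all_analysis.

Set Implicit Arguments.
Unset Strict Implicit.
Unset Printing Implicit Defensive.

Import Order.TTheory GRing.Theory Num.Theory.
Import numFieldNormedType.Exports.

Local Open Scope classical_set_scope.
Local Open Scope ring_scope.

(* The library norm of ['rV[R]_2] is the maximum norm.  It is equivalent to the
   Euclidean norm, so topology and differentiability do not depend on the
   choice, but conformality and the unit disk do. *)
Definition enorm (R : realType) (x : 'rV[R]_2) : R :=
  Num.sqrt (\sum_(i < 2) x ord0 i ^+ 2).

Definition domain (T : topologicalType) (A : set T) : Prop :=
  [/\ A !=set0, open A & connected A].

(* Every closed curve in [A] contracts to its base point inside [A], through
   closed curves with that base point.  Path-connectedness is not required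
   here: it is automatic for the domains of the plane. *)
Definition loops_contractible (R : realType) (T : topologicalType)
    (A : set T) : Prop :=
  forall g : R -> T,
    {within `[0, 1], continuous g} -> set_fun `[0, 1] A g -> g 0 = g 1 ->
  exists H : R * R -> T,
    [/\ {within `[0, 1] `*` `[0, 1], continuous H},
        set_fun (`[0, 1] `*` `[0, 1]) A H,
        forall t : R, t \in `[0, 1] -> H (0, t) = g t,
        forall t : R, t \in `[0, 1] -> H (1, t) = g 0 &
        forall s : R, s \in `[0, 1] -> H (s, 0) = g 0 /\ H (s, 1) = g 0].

Definition simply_connected_domain (R : realType) (A : set 'rV[R]_2) : Prop :=
  domain A /\ loops_contractible R A.

Definition continuously_differentiable (R : realType) (A : set 'rV[R]_2)
    (f : 'rV[R]_2 -> 'rV[R]_2) : Prop :=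
  forall x, A x -> differentiable f x /\ {for x, continuous (jacobian f)}.

(* Only the values of [f] on [A] matter: [A] is open, hence [x + h] lies in
   [A] for all small [h]. *)
Definition conformal (R : realType) (A B : set 'rV[R]_2)
    (f : 'rV[R]_2 -> 'rV[R]_2) : Prop :=
  [/\ domain A, domain B, set_bij A B f, continuously_differentiable A f &
      forall x, A x -> exists M : R,
        (fun h => enorm (f (x + h) - f x)) =
          (fun h => M * enorm h) +o_ (nbhs (0 : 'rV[R]_2)) (@enorm R)].

Definition unit_disk (R : realType) : set 'rV[R]_2 := [set x | enorm x < 1].
Arguments unit_disk : clear implicits.

(* Main.v *)
(* The maximal map is sought among the injective holomorphic f : Omega -> D with
   f z0 = 0, by maximizing |f z1| for a second point z1: if f omits a point of
   the disk, Koebe's square root trick yields a competitor h with f = h * m and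
   |m| < 1.  No integral is needed if holomorphic is taken to mean that complex
   derivatives of all orders exist.  The maximum principle holds
   because Re f + k |z|^2 has no interior maximum, by averaging the second order
   Taylor expansion over the points t, it, -t, -it.  Applied to
   (f z - f a) / (z - a) it gives the Schwarz lemma, hence Cauchy estimates, and
   pointwise limits along an ultrafilter of locally bounded holomorphic
   functions are holomorphic.  Hurwitz's theorem follows by iterating square
   roots of nonvanishing functions.  Simple connectedness is used only to lift
   paths and homotopies through the square map of C^*. *)

Require Import Defs.
From mathcomp Require Import all_boot all_order all_algebra.
From mathcomp Require Import all_classical all_reals all_analysis.
From mathcomp Require Import complex ring lra.

Set Implicit Arguments.
Unset Strict Implicit.
Unset Printing Implicit Defensive.

Import Order.TTheory GRing.Theory Num.Theory.
Import numFieldNormedType.Exports.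

Local Open Scope classical_set_scope.
Local Open Scope ring_scope.

(** * Modulus and limits in R[i] *)

Section ComplexModulus.
Variable R : realType.
Local Notation C := R[i].
Implicit Types z w : C.

(** Requiring derivatives of all orders spares Goursat's theorem, at the price that every
    construction in use (inverse, square root, limit) must again yield all orders; each does so by
    induction on the order. The maximum principle is stated for functions with merely a second order
    expansion at interior points, since this is what is known of the quotient in the Schwarz lemma
    at its centre. Along an ultrafilter every bounded sequence converges, so limits exist at all
    points at once without subsequences, and local Lipschitz bounds uniform in the index carry
    derivatives to the limit. Counting zeros by the argument principle would need an integral;
    Hurwitz's theorem rests instead on a quantitative bound: a nonvanishing function of modulus at
    most 1 that is tiny at a point is small in a fixed disk around it. *)

Definition nm z : R := ComplexField.Normc.normc z.

(** The norm of [R[i]] takes its values in [R[i]]; the real-valued [nm] opens moduli to real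
    arithmetic, and this is the bridge. *)
Lemma nmE z : `|z| = (nm z)%:C%C. Proof. by case: z. Qed.

Lemma nm_ge0 z : 0 <= nm z.
Proof. by rewrite -lecR -nmE normr_ge0. Qed.

Lemma nm0 : nm 0 = 0.
Proof. by apply: complexI; rewrite -nmE normr0. Qed.

Lemma nm1 : nm 1 = 1.
Proof. by apply: complexI; rewrite -nmE normr1. Qed.

Lemma nm_eq0 z : (nm z == 0) = (z == 0).
Proof. by rewrite -[RHS]normr_eq0 nmE; apply/eqP/eqP => [->//|/complexI]. Qed.

Lemma nm_gt0 z : (0 < nm z) = (z != 0).
Proof. by rewrite lt_def nm_ge0 andbT nm_eq0. Qed.

Lemma nmM z w : nm (z * w) = nm z * nm w.
Proof. exact: ComplexField.Normc.normcM. Qed.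

Lemma nmV z : nm z^-1 = (nm z)^-1.
Proof. exact: ComplexField.Normc.normcV. Qed.

Lemma nmN z : nm (- z) = nm z. Proof. exact: normcN. Qed.

Lemma nmC z w : nm (z - w) = nm (w - z). Proof. by rewrite -nmN opprB. Qed.

Lemma nmX z n : nm (z ^+ n) = nm z ^+ n.
Proof. by elim: n => [|n IH]; rewrite ?expr0 ?nm1// !exprS nmM IH. Qed.

Lemma ler_nmD z w : nm (z + w) <= nm z + nm w.
Proof. exact: le_normcD. Qed.

Lemma ler_nmB z w : nm (z - w) <= nm z + nm w.
Proof. by rewrite -(nmN w) ler_nmD. Qed.

Lemma ler_nm_dist z w : nm z - nm w <= nm (z - w).
Proof. by rewrite lerBlDr -{1}(subrK w z) ler_nmD. Qed.

Lemma nm_real (x : R) : nm x%:C%C = `|x|.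
Proof. by rewrite /nm /= expr0n /= addr0 sqrtr_sqr. Qed.

Lemma nm_sqr z : nm z ^+ 2 = complex.Re z ^+ 2 + complex.Im z ^+ 2.
Proof. by case: z => a b; rewrite /nm /= sqr_sqrtr // addr_ge0 ?sqr_ge0. Qed.

Lemma ler_Re z : `|complex.Re z| <= nm z.
Proof.
rewrite -(@ler_pXn2r _ 2) ?nnegrE ?nm_ge0 //.
by rewrite nm_sqr real_normK ?num_real // lerDl sqr_ge0.
Qed.

Lemma ler_Im z : `|complex.Im z| <= nm z.
Proof.
rewrite -(@ler_pXn2r _ 2) ?nnegrE ?nm_ge0 //.
by rewrite nm_sqr real_normK ?num_real // lerDr sqr_ge0.
Qed.

Lemma nm_leD z : nm z <= `|complex.Re z| + `|complex.Im z|.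
Proof.
rewrite {1}[z]complexE; apply: (le_trans (ler_nmD _ _)).
by rewrite nmM !nm_real /nm /= expr0n expr1n /= add0r sqrtr1 mul1r.
Qed.

Lemma Re_add z w : complex.Re (z + w) = complex.Re z + complex.Re w.
Proof. by case: z; case: w. Qed.
Lemma Re_sub z w : complex.Re (z - w) = complex.Re z - complex.Re w.
Proof. by case: z; case: w. Qed.
Lemma Im_add z w : complex.Im (z + w) = complex.Im z + complex.Im w.
Proof. by case: z; case: w. Qed.
Lemma Im_sub z w : complex.Im (z - w) = complex.Im z - complex.Im w.
Proof. by case: z; case: w. Qed.
Lemma Re_mul z w : complex.Re (z * w)
  = complex.Re z * complex.Re w - complex.Im z * complex.Im w.
Proof. by case: z; case: w. Qed.
Lemma Im_mul z w : complex.Im (z * w)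
  = complex.Re z * complex.Im w + complex.Im z * complex.Re w.
Proof. by case: z; case: w. Qed.

Lemma Re_le z : complex.Re z <= nm z.
Proof. exact: le_trans (ler_norm _) (ler_Re z). Qed.

Lemma nm_conj z : nm (conjc z) = nm z.
Proof. by case: z => a b; rewrite /nm /= sqrrN. Qed.

Lemma mul_conjc z : z * conjc z = (nm z ^+ 2)%:C%C.
Proof.
rewrite nm_sqr; case: z => a b; apply/eqP; rewrite eq_complex /=.
by apply/andP; split; apply/eqP; ring.
Qed.

Lemma nm2 : nm 2 = 2.
Proof.
rewrite -[2 in LHS](_ : (2 : R)%:C%C = 2) ?nm_real ?ger0_norm//.
by rewrite rmorphD rmorph1.
Qed.

End ComplexModulus.

Arguments nm {R} z : simpl never.

(** * Limits of complex-valued functions along filters *)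

Section ComplexLimits.
Variable R : realType.
Local Notation C := R[i].
Implicit Types z w : C.

(** One notion for three kinds of filter: [cn z] for functions of a complex variable, [nbhs] for
    paths and homotopies, an ultrafilter on [nat] for sequences of functions. *)
Definition clim (T : Type) (F : set_system T) (f : T -> C) (l : C) : Prop :=
  forall e : R, 0 < e -> \forall x \near F, nm (f x - l) < e.

(** The balls are not punctured: a limit along [cn z] is the value at [z]. *)
Definition cn z : set_system C :=
  [set P | exists2 r : R, 0 < r & forall w, nm (w - z) < r -> P w].

#[global] Instance cn_filter z : ProperFilter (cn z).
Proof.
split; last split.
- by case=> r r0 /(_ z); rewrite subrr nm0; exact.
- by exists 1.
- move=> P Q [r r0 Pr] [s s0 Qs]; exists (Num.min r s).
    by rewrite lt_min r0 s0.
  by move=> w; rewrite lt_min => /andP[/Pr ? /Qs].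
- by move=> P Q PQ [r r0 Pr]; exists r => // w /Pr/PQ.
Qed.

Lemma cn_ball z (r : R) : 0 < r -> \forall w \near cn z, nm (w - z) < r.
Proof. by exists r. Qed.

Section Filter.
Variables (T : Type) (F : set_system T).
Context {FF : Filter F}.
Implicit Types (f g : T -> C) (a b : C).

(** The constant [K] absorbs the factors that estimates produce, and [e <= 1] lets a product of two
    errors be bounded by [e]. *)
Lemma clim_le f l (K : R) : 
  (forall e : R, 0 < e -> e <= 1 -> \forall x \near F, nm (f x - l) <= K * e) ->
  clim F f l.
Proof.
move=> H e e0; set K' := Num.max K 1.
have K'0 : 0 < K' by rewrite lt_max ltr01 orbT.
set d := Num.min 1 (e / (2 * K')).
have d0 : 0 < d by rewrite lt_min ltr01 divr_gt0// mulr_gt0.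
apply: filterS (H d d0 _) => [x|]; last by rewrite ge_min lexx.
move=> /le_lt_trans; apply; apply: (@le_lt_trans _ _ (K' * d)).
  by rewrite ler_pM2r// le_max lexx.
apply: (@le_lt_trans _ _ (K' * (e / (2 * K')))).
  by rewrite ler_pM2l// ge_min lexx orbT.
have -> : K' * (e / (2 * K')) = e / 2 by field; rewrite gt_eqF.
by rewrite ltr_pdivrMr// ltr_pMr// ltr1n.
Qed.

Lemma clim_near f g l : (\forall x \near F, f x = g x) -> clim F f l -> clim F g l.
Proof. by move=> fg H e /H; apply: filterS2 fg => x ->. Qed.

Lemma clim_cst a : clim F (fun=> a) a.
Proof. by move=> e e0; apply: nearW => x; rewrite subrr nm0. Qed.

Lemma climD f g a b : clim F f a -> clim F g b -> clim F (fun x => f x + g x) (a + b).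
Proof.
move=> fa gb; apply: (@clim_le _ _ 2) => e e0 _.
apply: filterS2 (fa e e0) (gb e e0) => x fx gx.
have -> : f x + g x - (a + b) = (f x - a) + (g x - b) by ring.
by have := ler_nmD (f x - a) (g x - b); lra.
Qed.

Lemma climM f g a b : clim F f a -> clim F g b -> clim F (fun x => f x * g x) (a * b).
Proof.
move=> fa gb; apply: (@clim_le _ _ (1 + nm a + nm b)) => e e0 e1.
apply: filterS2 (fa e e0) (gb e e0) => x fx gx.
have -> : f x * g x - a * b
  = (f x - a) * (g x - b) + a * (g x - b) + (f x - a) * b by ring.
rewrite (_ : (1 + _ + _) * e = e + nm a * e + nm b * e); last by ring.
apply: (le_trans (ler_nmD _ _)); rewrite lerD//.
  apply: (le_trans (ler_nmD _ _)); rewrite lerD// nmM.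
    by rewrite -[leRHS]mulr1 ler_pM ?nm_ge0// ltW// (lt_le_trans gx).
  by rewrite ler_wpM2l ?nm_ge0// ltW.
by rewrite nmM mulrC ler_wpM2l ?nm_ge0// ltW.
Qed.

Lemma climN f a : clim F f a -> clim F (fun x => - f x) (- a).
Proof. by move=> fa e /fa; apply: filterS => x; rewrite -opprD nmN. Qed.

Lemma climB f g a b : clim F f a -> clim F g b -> clim F (fun x => f x - g x) (a - b).
Proof. by move=> fa /climN; exact: climD. Qed.

Lemma clim_nz f a : clim F f a -> a != 0 -> \forall x \near F, nm a / 2 < nm (f x).
Proof.
move=> fa a0; have na : 0 < nm a / 2 by rewrite divr_gt0 ?nm_gt0.
apply: filterS (fa _ na) => x.
by have := ler_nm_dist a (f x); rewrite nmC; lra.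
Qed.

Lemma climV f a : clim F f a -> a != 0 -> clim F (fun x => (f x)^-1) a^-1.
Proof.
move=> fa a0; have na : 0 < nm a by rewrite nm_gt0.
apply: (@clim_le _ _ (2 / nm a ^+ 2)) => e e0 e1.
apply: filterS2 (clim_nz fa a0) (fa e e0) => x fx1 fx2.
have fx0 : 0 < nm (f x) by apply: lt_trans fx1; rewrite divr_gt0.
have fn0 : f x != 0 by rewrite -nm_gt0.
have -> : (f x)^-1 - a^-1 = (a - f x) / (f x * a) by field; rewrite a0 fn0.
rewrite nmM nmV nmM nmC ler_pdivrMr ?mulr_gt0//.
apply: (le_trans (ltW fx2)).
have -> : 2 / nm a ^+ 2 * e * (nm (f x) * nm a) = e * (nm (f x) / (nm a / 2)).
  by field; rewrite gt_eqF.
apply: ler_peMr; first exact: ltW.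
by rewrite ler_pdivlMr ?divr_gt0// mul1r ltW.
Qed.

Lemma clim_comp f (g : C -> C) a b :
  clim F f a -> clim (cn a) g b -> g a = b -> clim F (g \o f) b.
Proof.
move=> fa gb gab e /gb[r r0 Hr].
by apply: filterS (fa _ r0) => x /Hr.
Qed.

End Filter.

Section ProperFilter.
Variables (T : Type) (F : set_system T).
Context {FF : ProperFilter F}.
Implicit Types (f : T -> C) (a b : C).

Lemma clim_unique f a b : clim F f a -> clim F f b -> a = b.
Proof.
move=> fa fb; apply/eqP; rewrite -subr_eq0 -nm_eq0; apply/negPn/negP => ab.
have e0 : 0 < nm (a - b) / 2 by rewrite divr_gt0// lt_def ab nm_ge0.
have [x [xa xb]] := filter_ex (filterI (fa _ e0) (fb _ e0)).
have := ler_nmD (a - f x) (f x - b).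
by rewrite subrKA (nmC a (f x)); lra.
Qed.

Lemma clim_nm_le f a (M : R) :
  clim F f a -> (\forall x \near F, nm (f x) <= M) -> nm a <= M.
Proof.
move=> fa fM; apply/ler_addgt0Pr => e e0.
have [x [xa xM]] := filter_ex (filterI (fa _ e0) fM).
by have := ler_nm_dist a (f x); rewrite nmC; lra.
Qed.

End ProperFilter.


Lemma clim_id z : clim (cn z) id z.
Proof. by move=> e e0; exact: cn_ball. Qed.

End ComplexLimits.

(** * Complex derivatives and holomorphic functions *)

Section ComplexDerivative.
Variable R : realType.
Local Notation C := R[i].
Implicit Types (f g : C -> C) (z w d : C).

Lemma cn_self z (P : set C) : cn z P -> P z.
Proof. by case=> r r0; apply; rewrite subrr nm0. Qed.

(* Caratheodory's formulation: the difference quotient extends continuously to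
   [z].  Products, inverses and square roots then reduce to algebra on the
   quotients. *)
Definition is_cd f z d : Prop :=
  exists2 q : C -> C, clim (cn z) q d &
    \forall w \near cn z, f w - f z = q w * (w - z).

(** The remainder form serves for estimates; to return from it, the quotient is completed by the
    value [d] at [z]. *)
Lemma is_cdP f z d : is_cd f z d <->
  forall e : R, 0 < e ->
    \forall w \near cn z, nm (f w - f z - d * (w - z)) <= e * nm (w - z).
Proof.
split=> [[q qd Hq] e e0|H].
  apply: filterS2 (qd e e0) Hq => w qw ->.
  by rewrite -mulrBl nmM ler_wpM2r ?nm_ge0// ltW.
exists (fun w => if w == z then d else (f w - f z) / (w - z)).
  apply: (@clim_le _ _ _ _ _ _ 1) => e e0 _; apply: filterS (H e e0) => w.
  case: eqVneq => [->|wz]; first by rewrite !subrr nm0 mul1r (ltW e0).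
  have wz0 : w - z != 0 by rewrite subr_eq0.
  have -> : (f w - f z) / (w - z) - d = (f w - f z - d * (w - z)) / (w - z).
    by field.
  by rewrite mul1r nmM nmV ler_pdivrMr// nm_gt0.
apply: nearW => w; case: eqVneq => [->|wz]; first by rewrite !subrr mulr0.
by rewrite divfK// subr_eq0.
Qed.

Lemma is_cd_cont f z d : is_cd f z d -> clim (cn z) f (f z).
Proof.
case=> q qd Hq; have H : clim (cn z) (fun w => f z + q w * (w - z)) (f z).
  have := climD (clim_cst (f z)) (climM qd (climB (@clim_id R z) (clim_cst z))).
  by rewrite subrr mulr0 addr0; exact.
by apply: clim_near H; apply: filterS Hq => w <-; rewrite addrC subrK.
Qed.

Lemma is_cd_near f g z d :
  (\forall w \near cn z, f w = g w) -> is_cd f z d -> is_cd g z d.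
Proof.
move=> fg [q qd Hq]; exists q => //.
have fgz := cn_self fg.
by apply: filterS2 fg Hq => w <- <-; rewrite fgz.
Qed.

Lemma is_cd_unique f z d d' : is_cd f z d -> is_cd f z d' -> d = d'.
Proof.
move=> /is_cdP H /is_cdP H'; apply/eqP; rewrite -subr_eq0 -nm_eq0.
apply/negPn/negP => dd; have n0 : 0 < nm (d - d') by rewrite lt_def dd nm_ge0.
have e0 : 0 < nm (d - d') / 3 by rewrite divr_gt0.
have [r r0 Hr] := filterI (H _ e0) (H' _ e0).
pose w := z + (r / 2)%:C%C.
have wz : nm (w - z) = r / 2.
  by rewrite /w addrC addKr nm_real ger0_norm// divr_ge0// ltW.
have [] := Hr w; first by rewrite wz ltr_pdivrMr// ltr_pMr// ltr1n.
rewrite wz; set a := f w - f z => h1 h2.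
have := ler_nmB (a - d' * (w - z)) (a - d * (w - z)).
have -> : a - d' * (w - z) - (a - d * (w - z)) = (d - d') * (w - z) by ring.
by rewrite nmM wz; nra.
Qed.

Lemma is_cd_cst (a z : C) : is_cd (fun=> a) z 0.
Proof.
exists (fun=> 0); first exact: clim_cst.
by apply: nearW => w; rewrite subrr mul0r.
Qed.

Lemma is_cd_id z : is_cd id z 1.
Proof.
exists (fun=> 1); first exact: clim_cst.
by apply: nearW => w; rewrite mul1r.
Qed.

Lemma is_cdD f g z a b : is_cd f z a -> is_cd g z b ->
  is_cd (fun w => f w + g w) z (a + b).
Proof.
case=> p pa Hp [q qb Hq]; exists (fun w => p w + q w); first exact: climD.
by apply: filterS2 Hp Hq => w h1 h2; rewrite mulrDl -h1 -h2; ring.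
Qed.

Lemma is_cdM f g z a b : is_cd f z a -> is_cd g z b ->
  is_cd (fun w => f w * g w) z (a * g z + f z * b).
Proof.
move=> fa gb; have gc := is_cd_cont gb; case: fa gb => p pa Hp [q qb Hq].
exists (fun w => p w * g w + f z * q w).
  by apply: climD; apply: climM => //; exact: clim_cst.
apply: filterS2 Hp Hq => w h1 h2.
by rewrite mulrDl mulrAC -h1 -mulrA -h2; ring.
Qed.

Lemma is_cdZ f z a (c : C) : is_cd f z a -> is_cd (fun w => c * f w) z (c * a).
Proof.
by move=> /(is_cdM (is_cd_cst c z)); rewrite mul0r add0r.
Qed.

Lemma is_cdV f z a : is_cd f z a -> f z != 0 ->
  is_cd (fun w => (f w)^-1) z (- a / f z ^+ 2).
Proof.
move=> fa fz; have fc := is_cd_cont fa; case: fa => p pa Hp.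
exists (fun w => - p w * ((f w)^-1 / f z)).
  rewrite expr2 invfM; apply: climM; first exact: climN.
  by apply: climM; [exact: climV|exact: clim_cst].
apply: filterS2 Hp (clim_nz fc fz) => w h1 h2.
have fw : f w != 0.
  by rewrite -nm_gt0 (lt_trans _ h2)// divr_gt0// nm_gt0.
rewrite !mulNr mulrAC -h1; field; by rewrite fw fz.
Qed.

(** Continuity of the root yields its derivative: [g w - g z = (f w - f z) / (g w + g z)], and the
    denominator tends to [2 * g z], which is nonzero. *)
Lemma is_cd_sqrt f g z a : clim (cn z) g (g z) -> g z != 0 ->
  (\forall w \near cn z, g w ^+ 2 = f w) ->
  is_cd f z a -> is_cd g z (a / 2 / g z).
Proof.
move=> gc gz gf [p pa Hp].
have s0 : g z + g z != 0 by rewrite -mulr2n mulrn_eq0.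
have sc : clim (cn z) (fun w => g w + g z) (g z + g z).
  by apply: climD => //; exact: clim_cst.
exists (fun w => p w / (g w + g z)).
  rewrite (_ : a / 2 / g z = a * (g z + g z)^-1).
    by apply: climM => //; exact: climV.
  by rewrite -[g z + g z]mulr2n -(mulr_natl (g z)) invfM mulrA.
have g2 := cn_self gf.
apply: filterS3 Hp gf (clim_nz sc s0) => w h1 h2 h3.
have sw : g w + g z != 0.
  by rewrite -nm_gt0 (lt_trans _ h3)// divr_gt0// nm_gt0.
by rewrite mulrAC -h1 -h2 -g2 subr_sqr mulfK.
Qed.

Definition opn (A : set C) := forall z, A z -> cn z A.

Definition cball z (r : R) : set C := [set w | nm (w - z) < r].

Lemma opn_cball z r : opn (cball z r).
Proof.
move=> w /= wr; exists (r - nm (w - z)); first by rewrite subr_gt0.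
move=> v vw; rewrite /cball /=; have := ler_nmD (v - w) (w - z).
by rewrite subrKA; lra.
Qed.

Fixpoint hol (n : nat) (A : set C) f : Prop :=
  if n is m.+1 then
    exists2 g, (forall z, A z -> is_cd f z (g z)) & hol m A g
  else True.

Definition holo (A : set C) f := forall n, hol n A f.

Section Hol.
Variable A : set C.
Hypothesis Aopn : opn A.

Lemma hol_eq n f g : (forall z, A z -> f z = g z) -> hol n A f -> hol n A g.
Proof.
case: n => //= n fg [f' Hf' hf']; exists f' => // z Az.
by apply: is_cd_near (Hf' z Az); apply: filterS (Aopn Az).
Qed.

Lemma holS n f : hol n.+1 A f -> hol n A f.
Proof.
elim: n f => //= n IH f [g fg Hg]; exists g => //; exact: IH.
Qed.

Lemma hol_cst n (a : C) : hol n A (fun=> a).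
Proof.
elim: n a => //= n IH a; exists (fun=> 0) => // z _; exact: is_cd_cst.
Qed.

Lemma hol_id n : hol n A id.
Proof.
case: n => //= n; exists (fun=> 1); last exact: hol_cst.
move=> z _; exact: is_cd_id.
Qed.

Lemma holD n f g : hol n A f -> hol n A g -> hol n A (fun z => f z + g z).
Proof.
elim: n f g => //= n IH f g [f' ff' hf'] [g' gg' hg'].
exists (fun z => f' z + g' z); last exact: IH.
by move=> z Az; apply: is_cdD; [exact: ff'|exact: gg'].
Qed.

Lemma holM n f g : hol n A f -> hol n A g -> hol n A (fun z => f z * g z).
Proof.
elim: n f g => // n IH f g hf hg.
have [hf1 hg1] := (holS hf, holS hg).
case: hf => f' ff' hf'; case: hg => g' gg' hg'.
exists (fun z => f' z * g z + f z * g' z); last by apply: holD; apply: IH.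
by move=> z Az; apply: is_cdM; [exact: ff'|exact: gg'].
Qed.

(** The derivative contains the inverse again, but with one order fewer to establish, which the
    induction hypothesis supplies; [hol_sqrt] follows the same pattern. *)
Lemma holV n f : (forall z, A z -> f z != 0) -> hol n A f ->
  hol n A (fun z => (f z)^-1).
Proof.
move=> f0; elim: n => // n IH hf; have hfi := IH (holS hf).
case: hf => f' ff' hf'.
exists (fun z => (-1) * f' z * ((f z)^-1 * (f z)^-1)).
  move=> z Az; have := is_cdV (ff' z Az) (f0 z Az).
  by rewrite mulN1r expr2 invfM.
by do ?apply: holM => //; exact: hol_cst.
Qed.

Lemma hol_sqrt n f g : (forall z, A z -> f z != 0) ->
  (forall z, A z -> clim (cn z) g (g z)) -> (forall z, A z -> g z ^+ 2 = f z) ->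
  hol n A f -> hol n A g.
Proof.
move=> f0 gc gf; elim: n => // n IH hf; have hg := IH (holS hf).
have g0 z : A z -> g z != 0.
  by move=> Az; move: (f0 z Az); rewrite -gf// sqrf_eq0.
case: hf => f' ff' hf'.
exists (fun z => f' z * 2^-1 * (g z)^-1).
  move=> z Az; apply: is_cd_sqrt (ff' z Az); [exact: gc|exact: g0|].
  exact: filterS (Aopn Az).
by apply: holM; [apply: holM => //; exact: hol_cst|exact: holV].
Qed.

Lemma holo_eq f g : (forall z, A z -> f z = g z) -> holo A f -> holo A g.
Proof. by move=> fg hf n; exact: hol_eq (hf n). Qed.
Lemma holo_cst a : holo A (fun=> a). Proof. by move=> n; exact: hol_cst. Qed.
Lemma holo_id : holo A id. Proof. by move=> n; exact: hol_id. Qed.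
Lemma holoD f g : holo A f -> holo A g -> holo A (fun z => f z + g z).
Proof. by move=> hf hg n; exact: holD. Qed.
Lemma holoM f g : holo A f -> holo A g -> holo A (fun z => f z * g z).
Proof. by move=> hf hg n; exact: holM. Qed.
Lemma holoB f g : holo A f -> holo A g -> holo A (fun z => f z - g z).
Proof.
move=> hf hg; apply: (@holo_eq (fun z => f z + (-1) * g z)).
  by move=> z _; rewrite mulN1r.
by apply: holoD => //; apply: holoM => //; exact: holo_cst.
Qed.
Lemma holoV f : (forall z, A z -> f z != 0) -> holo A f ->
  holo A (fun z => (f z)^-1).
Proof. by move=> f0 hf n; exact: holV. Qed.
Lemma holo_sqrt f g : (forall z, A z -> f z != 0) ->
  (forall z, A z -> clim (cn z) g (g z)) -> (forall z, A z -> g z ^+ 2 = f z) ->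
  holo A f -> holo A g.
Proof. by move=> f0 gc gf hf n; exact: hol_sqrt (hf n). Qed.

(** The chains of derivatives granted for different orders may be different functions; by uniqueness
    their first members agree on [A], so one derivative has all orders. *)
Lemma holo_deriv f : holo A f ->
  exists2 g, (forall z, A z -> is_cd f z (g z)) & holo A g.
Proof.
move=> hf; have [g fg _] := hf 1; exists g => // n.
have [g' fg' hg'] := hf n.+1; apply: hol_eq hg' => z Az.
exact: is_cd_unique (fg' z Az) (fg z Az).
Qed.

Lemma holo_cont f z : holo A f -> A z -> clim (cn z) f (f z).
Proof. by move=> /holo_deriv[g fg _] /fg /is_cd_cont. Qed.

End Hol.

Lemma hol_sub n (A B : set C) f : B `<=` A -> hol n A f -> hol n B f.
Proof.
move=> BA; elim: n f => //= n IH f [g fg hg]; exists g; last exact: IH.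
by move=> z /BA; exact: fg.
Qed.

Lemma holo_sub (A B : set C) f : B `<=` A -> holo A f -> holo B f.
Proof. by move=> BA hf n; exact: hol_sub (hf n). Qed.

End ComplexDerivative.

(** * Taylor expansions and maxima *)

Section MaximumPrinciple.
Variable R : realType.
Local Notation C := R[i].
Implicit Types (f g : C -> C) (z w : C).

Definition seg (a b : C) (t : R) : C := a + t%:C%C * (b - a).

Lemma seg0 a b : seg a b 0 = a. Proof. by rewrite /seg mul0r addr0. Qed.
Lemma seg1 a b : seg a b 1 = b. Proof. by rewrite /seg mul1r addrC subrK. Qed.

Lemma nm_seg a b t : nm (seg a b t - a) = `|t| * nm (b - a).
Proof. by rewrite /seg [a + _]addrC addrK nmM nm_real. Qed.

Lemma segB a b s t : seg a b s - seg a b t = (s - t)%:C%C * (b - a).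
Proof. by rewrite rmorphB /seg /=; ring. Qed.

Lemma is_derive_Re_seg f (a b c d : C) (t : R) : is_cd f (seg a b t) d ->
  is_derive t 1 (fun s => complex.Re (c * f (seg a b s)))
                (complex.Re (c * (d * (b - a)))).
Proof.
move=> /is_cdP H.
suff K : h^-1 *: (complex.Re (c * f (seg a b (h *: 1 + t))) - complex.Re (c * f (seg a b t)))
   @[h --> 0^'] --> complex.Re (c * (d * (b - a))).
  by apply: DeriveDef; [apply/cvg_ex; eexists; exact: K|exact: cvg_lim].
apply/cvgrPdist_le => e e0; set K := 1 + nm c * nm (b - a).
have K0 : 0 < K by rewrite ltr_pwDl// mulr_ge0 ?nm_ge0.
have [r r0 Hr] := H (e / K) (divr_gt0 e0 K0).
have K1 : 0 < 1 + nm (b - a) by rewrite ltr_pwDl// nm_ge0.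
near=> h.
have h0 : h != 0 by near: h; exact: nbhs_dnbhs_neq.
have hr : `|h| < r / (1 + nm (b - a)).
  by near: h; apply: dnbhs0_lt; rewrite divr_gt0.
have := Hr (seg a b (h *: 1 + t)).
rewrite segB addrK nmM nm_real [h *: 1]mulr1.
move: hr; rewrite ltr_pdivlMr// mulrDr mulr1 => hr.
have hr' : `|h| * nm (b - a) < r by rewrite (le_lt_trans _ hr)// lerDr.
move=> /(_ hr'); set X := f _ - f _ - _ => hX.
have -> : complex.Re (c * (d * (b - a))) - h^-1 *: (complex.Re (c * f (seg a b (h + t)))
    - complex.Re (c * f (seg a b t))) = - (h^-1 * complex.Re (c * X)).
  rewrite -Re_sub -mulrBr -[_ - f _](subrK (d * (h%:C%C * (b - a)))) -/X.
  rewrite [c * (X + _)]mulrDr Re_add /GRing.scale /=.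
  have -> : c * (d * (h%:C%C * (b - a))) = h%:C%C * (c * (d * (b - a))) by ring.
  rewrite (Re_mul (h%:C%C)) /= mul0r subr0.
  by field.
rewrite normrN normrM normfV ler_pdivrMl ?normr_gt0//.
apply: (le_trans (ler_Re _)); rewrite nmM.
apply: (le_trans (ler_wpM2l (nm_ge0 _) hX)).
have -> : nm c * (e / K * (`|h| * nm (b - a)))
   = (`|h| * e) * (nm c * nm (b - a) / K) by field; rewrite gt_eqF.
apply: ler_piMr; first by rewrite mulr_ge0// ltW.
by rewrite ler_pdivrMr// mul1r lerDr.
Unshelve. all: by end_near. Qed.

(** For complex values the mean value theorem fails as an equality. It is applied to the real part
    of [c * f] along the segment, where [c] is the conjugate of [f b - f a]: the increment of this
    real function is [nm (f b - f a) ^+ 2]. *)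
Lemma mean_value_le f f' (a b : C) (M : R) :
  (forall t : R, 0 <= t <= 1 -> is_cd f (seg a b t) (f' (seg a b t))) ->
  (forall t : R, 0 <= t <= 1 -> nm (f' (seg a b t)) <= M) ->
  nm (f b - f a) <= M * nm (b - a).
Proof.
move=> fd fM; set c := conjc (f b - f a).
have D (t : R) : 0 <= t <= 1 -> is_derive t 1 (fun s => complex.Re (c * f (seg a b s)))
                (complex.Re (c * (f' (seg a b t) * (b - a)))).
  by move=> /fd; exact: is_derive_Re_seg.
have D' (t : R) : t \in `[0, 1] -> derivable (fun s => complex.Re (c * f (seg a b s))) t 1.
  by rewrite in_itv => /= /D [].
have [t t01] := MVT ltr01 (fun t t01 => D t (subset_itv_oo_cc t01))
  (derivable_within_continuous D').
have t1 : 0 <= t <= 1 by have := subset_itv_oo_cc t01.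
rewrite seg0 seg1 subr0 mulr1 -Re_sub -mulrBr mulrC mul_conjc /= => E.
have [->|n0] := eqVneq (nm (f b - f a)) 0.
  rewrite mulr_ge0 ?nm_ge0//; exact: le_trans (nm_ge0 _) (fM t t1).
have {}n0 : 0 < nm (f b - f a) by rewrite lt_def n0 nm_ge0.
rewrite -(ler_pM2l n0) -expr2 E; apply: (le_trans (Re_le _)).
by rewrite /c 2!nmM nm_conj ler_pM2l// ler_wpM2r ?nm_ge0// fM.
Qed.

(** One cubic format for all orders in use; for [n] below 3 the surplus coefficients are taken to be
    0. *)
Definition taylor f z (a b c d : C) (n : nat) : Prop :=
  forall e : R, 0 < e -> \forall w \near cn z,
    nm (f w - (a + b * (w - z) + c * (w - z) ^+ 2 + d * (w - z) ^+ 3))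
      <= e * nm (w - z) ^+ n.

Lemma is_cd_eq f z d d' : is_cd f z d -> d = d' -> is_cd f z d'.
Proof. by move=> ? <-. Qed.

Lemma taylor_cont f z : clim (cn z) f (f z) -> taylor f z (f z) 0 0 0 0.
Proof.
move=> fc e e0; apply: filterS (fc e e0) => w.
by rewrite !mul0r !addr0 expr0 mulr1 => /ltW.
Qed.

(** Integration without an integral: along the segment from [z], the derivative of [f] minus the
    integrated polynomial is at most [e * nm (w - z) ^+ n], and the mean value inequality
    contributes one more factor [nm (w - z)]. *)
Lemma taylor_int f g z a b c n :
  (\forall w \near cn z, is_cd f w (g w)) -> taylor g z a b c 0 n ->
  taylor f z (f z) a (b / 2) (c / 3) n.+1.
Proof.
move=> fg T e e0; have [r r0 Hr] := filterI fg (T e e0).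
exists r => // w wr.
pose P v := f z + a * (v - z) + b / 2 * (v - z) ^+ 2 + c / 3 * (v - z) ^+ 3.
have D v : is_cd (fun w => f z + a * (w - z) + b / 2 * ((w - z) * (w - z))
    + c / 3 * ((w - z) * ((w - z) * (w - z)))) v
    (a + b * (v - z) + c * (v - z) ^+ 2).
  have hz : is_cd (fun w => w + - z) v (1 + 0).
    exact: is_cdD (is_cd_id _) (is_cd_cst _ _).
  have h2 := is_cdM hz hz; have h3 := is_cdM hz h2.
  apply: is_cd_eq; first apply: is_cdD (is_cdZ _ h3).
    by apply: is_cdD (is_cdZ _ h2); apply: is_cdD (is_cd_cst _ _) (is_cdZ _ hz).
  by field.
have hs (t : R) : 0 <= t <= 1 -> nm (seg z w t - z) <= nm (w - z).
  by case/andP=> t0 t1; rewrite nm_seg ger0_norm// ler_piMl// nm_ge0.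
suff: nm (f w - P w - (f z - P z)) <= e * nm (w - z) ^+ n * nm (w - z).
  have -> : P z = f z by rewrite /P subrr !expr0n /= !mulr0 !addr0.
  by rewrite subrr subr0 -mulrA -exprSr.
apply: (@mean_value_le (fun v => f v - P v)
   (fun v => g v - (a + b * (v - z) + c * (v - z) ^+ 2))) => t t01.
all: have [h1 h2] := Hr _ (le_lt_trans (hs t t01) wr).
  apply: is_cdD h1 _; rewrite -mulN1r.
  apply: is_cd_near (is_cdZ (-1) (D _)); apply: nearW => v.
  by rewrite /P; ring.
move: h2; rewrite mul0r addr0 => /le_trans; apply.
by rewrite ler_wpM2l ?(ltW e0)// lerXn2r ?nnegrE ?nm_ge0// hs.
Qed.

Lemma nbhs_cn (p : R * R) (P : set C) :
  cn (Complex p.1 p.2) P -> \forall q \near p, P (Complex q.1 q.2).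
Proof.
case=> r r0 Hr; apply/nbhs_ballP; exists (r / 2) => /=; first by rewrite divr_gt0.
move=> q [] /=; rewrite /ball /= => h1 h2; apply: Hr.
apply: (le_lt_trans (nm_leD _)) => /=.
by rewrite [ltRHS]splitr ltrD// distrC.
Qed.

Lemma compact_disc (z0 : C) (r : R) :
  compact [set p : R * R | nm (Complex p.1 p.2 - z0) <= r].
Proof.
pose B := `[complex.Re z0 - r, complex.Re z0 + r]%classic `*`
          `[complex.Im z0 - r, complex.Im z0 + r]%classic.
apply: (@subclosed_compact _ _ B).
- rewrite -[X in closed X]setCK; apply: open_closedC.
  rewrite openE => p /= /negP; rewrite -ltNge => pr; rewrite /interior /=.
  apply: (@nbhs_cn p (fun z => ~ nm (z - z0) <= r)).
  exists (nm (Complex p.1 p.2 - z0) - r).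
    by rewrite subr_gt0.
  move=> w; rewrite nmC => wp /=; apply/negP; rewrite -ltNge.
  have := ler_nmD (Complex p.1 p.2 - w) (w - z0).
  by rewrite subrKA; lra.
- by apply: compact_setX; exact: segment_compact.
- move=> [x y] /= pr; have := le_trans (ler_Re _) pr; have := le_trans (ler_Im _) pr.
  rewrite Re_sub Im_sub /= !ler_norml => h1 h2.
  by split; rewrite /= in_itv /=; lra.
Qed.

Lemma disc_max (phi : C -> R) (z0 : C) (r : R) : 0 <= r ->
  (forall z, nm (z - z0) <= r -> forall e : R, 0 < e ->
     \forall w \near cn z, `|phi z - phi w| < e) ->
  exists2 z, nm (z - z0) <= r & forall w, nm (w - z0) <= r -> phi w <= phi z.
Proof.
move=> r0 pc.
have [||p /set_mem /= pA pM] := @compact_EVT_max _ R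
  (fun p => phi (Complex p.1 p.2)) _ _ (@compact_disc z0 r).
- exists (complex.Re z0, complex.Im z0) => /=.
  by rewrite (_ : Complex _ _ = z0) ?subrr ?nm0//; case: (z0).
- apply: continuous_in_subspaceT => p /set_mem /= pA.
  apply/cvgrPdist_lt => e e0.
  apply: (@nbhs_cn p (fun w => `|phi (Complex p.1 p.2) - phi w| < e)).
  exact: pc.
- exists (Complex p.1 p.2) => // w wr.
  have E : Complex (complex.Re w) (complex.Im w) = w by case: (w).
  by have := pM (complex.Re w, complex.Im w); rewrite /= E; apply; rewrite inE /= E.
Qed.

End MaximumPrinciple.

(** * Maximum principle and Schwarz lemma *)

Section Schwarz.
Variable R : realType.
Local Notation C := R[i].
Implicit Types (f g : C -> C) (z w : C).

Lemma clim_conj (T : Type) (F : set_system T) {FF : Filter F} (f : T -> C) (a : C) :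
  clim F f a -> clim F (fun x => conjc (f x)) (conjc a).
Proof.
by move=> fa e /fa; apply: filterS => x; rewrite -rmorphB nm_conj.
Qed.

Lemma max_Re f z0 (r M : R) : 0 < r ->
  (forall z, nm (z - z0) <= r -> clim (cn z) f (f z)) ->
  (forall z, nm (z - z0) < r -> exists b c, taylor f z (f z) b c 0 2) ->
  (forall z, nm (z - z0) = r -> complex.Re (f z) <= M) ->
  forall z, nm (z - z0) <= r -> complex.Re (f z) <= M.
Proof.
move=> r0 fc ft fM z zr; apply/ler_addgt0Pr => e e0.
(* With this [k] the added term [k * nm (z - z0) ^+ 2] equals [e] on the boundary circle. *)
set k := e / r ^+ 2; have k0 : 0 < k by rewrite divr_gt0// exprn_gt0.
pose phi w := complex.Re (f w) + k * nm (w - z0) ^+ 2.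
have [z1 z1r z1M] : exists2 z, nm (z - z0) <= r &
    forall w, nm (w - z0) <= r -> phi w <= phi z.
  apply: disc_max => [|w wr d d0]; first exact: ltW.
  pose F w := f w + k%:C%C * ((w - z0) * conjc (w - z0)).
  have E v : phi v = complex.Re (F v).
    by rewrite /F mul_conjc Re_add Re_mul /= mul0r subr0.
  have : clim (cn w) F (F w).
    have h : clim (cn w) (fun v => v - z0) (w - z0).
      by apply: climB; [exact: clim_id|exact: clim_cst].
    apply: climD; first exact: fc.
    by apply: climM; [exact: clim_cst|apply: climM => //; exact: clim_conj].
  move=> /(_ d d0); apply: filterS => v; rewrite !E -Re_sub nmC.
  exact: le_lt_trans (ler_Re _).
suff z1E : nm (z1 - z0) = r.
  have := z1M z zr; rewrite /phi z1E {2}/k divfK ?gt_eqF ?exprn_gt0// => h.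
  have := fM z1 z1E; have : 0 <= k * nm (z - z0) ^+ 2.
    by rewrite mulr_ge0 ?(ltW k0)// exprn_ge0// nm_ge0.
  by lra.
apply/eqP; rewrite eq_le z1r leNgt; apply/negP => z1lt.
have [b [c T]] := ft z1 z1lt.
have [d d0 Hd] := T (k / 2) (divr_gt0 k0 (ltr0Sn _ 1)).
set s := r - nm (z1 - z0); have s0 : 0 < s by rewrite subr_gt0.
pose t := Num.min (d / 2) s.
have t0 : 0 < t by rewrite lt_min s0 divr_gt0.
have ts : t <= s by rewrite ge_min lexx orbT.
have td : t < d.
  apply: (@le_lt_trans _ _ (d / 2)); first by rewrite ge_min lexx.
  by rewrite ltr_pdivrMr// ltr_pMr// ltr1n.
have H (h : C) : nm h = t ->
    complex.Re (f z1 + b * h + c * h ^+ 2) - k / 2 * t ^+ 2 +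
      k * nm (z1 - z0 + h) ^+ 2 <= complex.Re (f z1) + k * nm (z1 - z0) ^+ 2.
  move=> ht; have E : z1 + h - z1 = h by rewrite addrC addKr.
  have := Hd (z1 + h); rewrite E ht mul0r addr0 => /(_ td) h1.
  have := z1M (z1 + h); rewrite (addrAC z1) /phi => h2.
  have := le_trans (Re_le _) h1; rewrite nmC in h1.
  have := le_trans (Re_le _) h1; rewrite !Re_sub => h3 h4.
  have := ler_nmD (z1 - z0) h; rewrite ht => h5.
  have /h2 : nm (z1 - z0 + h) <= r by move: ts; rewrite /s; lra.
  by rewrite (addrAC z1); lra.
have nt (h : C) : complex.Re h ^+ 2 + complex.Im h ^+ 2 = t ^+ 2 -> nm h = t.
  by move=> E; apply: (@pexpIrn _ 2) => //; rewrite ?nnegrE ?nm_ge0 ?(ltW t0)// nm_sqr.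
have e1 : nm (Complex t 0) = t by apply: nt => /=; ring.
have e2 : nm (Complex (- t) 0) = t by apply: nt => /=; ring.
have e3 : nm (Complex 0 t) = t by apply: nt => /=; ring.
have e4 : nm (Complex 0 (- t)) = t by apply: nt => /=; ring.
have t20 : 0 < k * t ^+ 2 by rewrite mulr_gt0 ?exprn_gt0.
(* Over the four points both [h] and [h ^+ 2] sum to 0, so [b] and [c] cancel. The squared distances
   gain [4 * t ^+ 2] in total; multiplied by [k], this beats the total error [2 * k * t ^+ 2]. *)
move: (H _ e1) (H _ e2) (H _ e3) (H _ e4).
rewrite !nm_sqr !Re_add !Im_add !Re_mul !Im_mul /=.
set x := complex.Re (z1 - z0); set y := complex.Im (z1 - z0).
move: t20; clear.
move: (complex.Re b) (complex.Im b) (complex.Re c) (complex.Im c) => b1 b2 c1 c2.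
by lra.
Qed.

Lemma max_nm f z0 (r M : R) : 0 < r ->
  (forall z, nm (z - z0) <= r -> clim (cn z) f (f z)) ->
  (forall z, nm (z - z0) < r -> exists b c, taylor f z (f z) b c 0 2) ->
  (forall z, nm (z - z0) = r -> nm (f z) <= M) ->
  forall z, nm (z - z0) <= r -> nm (f z) <= M.
Proof.
move=> r0 fc ft fM z zr; have [fz0|fz0] := eqVneq (f z) 0.
  (* A point of the boundary circle shows that [M] is nonnegative. *)
  rewrite fz0 nm0; apply: le_trans (nm_ge0 _) (fM (z0 + r%:C%C) _).
  by rewrite addrC addKr nm_real gtr0_norm.
have n0 : 0 < nm (f z) by rewrite nm_gt0.
(* Rotation by the unimodular [u] turns the modulus of [f z] into a real part. *)
pose u := (nm (f z))^-1%:C%C * conjc (f z).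
have nu : nm u = 1.
  by rewrite /u nmM nm_real nm_conj ger0_norm ?invr_ge0 ?nm_ge0// mulVf ?gt_eqF.
have -> : nm (f z) = complex.Re (u * f z).
  rewrite /u -mulrA [conjc _ * _]mulrC mul_conjc -rmorphM /=.
  by rewrite expr2 mulKf ?gt_eqF.
apply: (@max_Re (fun w => u * f w) z0 r) => // [w wr|w wr|w wr].
- by apply: climM; [exact: clim_cst|exact: fc].
- have [b [c T]] := ft w wr; exists (u * b), (u * c) => e e0.
  apply: filterS (T e e0) => v; rewrite !mul0r !addr0.
  have -> : u * f v - (u * f w + u * b * (v - w) + u * c * (v - w) ^+ 2) =
    u * (f v - (f w + b * (v - w) + c * (v - w) ^+ 2)) by ring.
  by rewrite nmM nu mul1r.
- by apply: le_trans (Re_le _) _; rewrite nmM nu mul1r fM.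
Qed.

Lemma opn_near (A P : set C) z : opn A -> (forall w, A w -> P w) -> A z ->
  \forall w \near cn z, P w.
Proof. by move=> oA AP /oA; exact: filterS. Qed.

Lemma taylor_clim f z b c d n : taylor f z (f z) b c d n -> clim (cn z) f (f z).
Proof.
move=> T; pose P w := f z + b * (w - z) + c * (w - z) ^+ 2 + d * (w - z) ^+ 3.
have h1 : clim (cn z) (fun v => v - z) 0.
  by rewrite -(subrr z); apply: climB; [exact: clim_id|exact: clim_cst].
have hP : clim (cn z) P (f z + b * 0 + c * (0 * 0) + d * (0 * (0 * 0))).
  exact: climD (climD (climD (clim_cst (f z)) (climM (clim_cst b) h1))
    (climM (clim_cst c) (climM h1 h1))) (climM (clim_cst d) (climM h1 (climM h1 h1))).
have h0 : clim (cn z) (fun w => f w - P w) 0.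
  apply: (@clim_le _ _ _ _ _ _ 1) => e e0 _.
  apply: filterS2 (T e e0) (cn_ball z ltr01) => w h w1.
  rewrite subr0 mul1r; apply: (le_trans h); rewrite ler_piMr ?(ltW e0)//.
  by rewrite exprn_ile1 ?nm_ge0// ltW.
have := climD h0 hP; rewrite !mulr0 !addr0 add0r => /(_ _) H.
by apply: clim_near H; apply: nearW => w; rewrite subrK.
Qed.

Lemma holo_taylor2 (A : set C) f z : opn A -> holo A f -> A z ->
  exists b c, taylor f z (f z) b c 0 2.
Proof.
move=> oA /(holo_deriv oA)[g fg hg] Az; have [h gh hh] := holo_deriv oA hg.
have T0 := taylor_cont (holo_cont oA hh Az).
have T1 := taylor_int (opn_near oA gh Az) T0; rewrite !mul0r in T1.
have T2 := taylor_int (opn_near oA fg Az) T1; rewrite !mul0r in T2.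
by exists (g z), (h z / 2).
Qed.

Lemma holo_taylor3 (A : set C) f z : opn A -> holo A f -> A z ->
  exists b c d, taylor f z (f z) b c d 3.
Proof.
move=> oA /(holo_deriv oA)[g fg hg] Az.
have [b [c T]] := holo_taylor2 oA hg Az.
by have := taylor_int (opn_near oA fg Az) T; exists (g z), (b / 2), (c / 3).
Qed.

(** The singularity of [f z / (z - z0)] needs no removal theorem: dividing the third order expansion
    of [f] at [z0] by [z - z0] gives the second order expansion that the maximum principle asks for,
    with value [a] at [z0]. *)
Lemma schwarz0 f z0 (r s M : R) : 0 < s -> s < r -> holo (cball z0 r) f ->
  f z0 = 0 -> (forall z, cball z0 r z -> nm (f z) <= M) ->
  forall z, nm (z - z0) <= s -> nm (f z) <= M / s * nm (z - z0).
Proof.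
move=> s0 sr hf f0 fM z zs; have o1 := @opn_cball R z0 r.
have z0r : cball z0 r z0 by rewrite /cball /= subrr nm0 (lt_trans s0).
have [a [b [c T]]] := holo_taylor3 o1 hf z0r.
pose A := cball z0 r `\` [set z0].
have oA : opn A.
  move=> w [/o1 wr wz].
  have n0 : 0 < nm (w - z0) by rewrite nm_gt0 subr_eq0; exact/eqP.
  apply: filterS2 wr (cn_ball w n0) => v h1 h2; split => // E; move: h2.
  by rewrite E nmC ltxx.
pose g w := if w == z0 then a else f w / (w - z0).
have gA : holo A g.
  apply: (@holo_eq _ _ oA (fun w => f w * (w - z0)^-1)).
    by move=> w [_ /eqP/negbTE wz]; rewrite /g wz.
  apply: holoM; first by apply: holo_sub hf => w [].
  apply: holoV => //; last by apply: holoB => //; [exact: holo_id|exact: holo_cst].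
  by move=> w [_ /eqP]; rewrite subr_eq0.
have T0 : taylor g z0 (g z0) b c 0 2.
  move=> e e0; apply: filterS (T e e0) => w.
  rewrite f0 /g eqxx; case: eqVneq => [->|wz].
    rewrite !subrr !expr0n /= !mulr0 !addr0 subrr nm0 => _.
    by rewrite expr0n mulr0.
  have wz0 : w - z0 != 0 by rewrite subr_eq0.
  have n0 : 0 < nm (w - z0) by rewrite nm_gt0.
  set X := (f w - _) => hX.
  have -> : f w / (w - z0) - (a + b * (w - z0) + c * (w - z0) ^+ 2 + 0 * (w - z0) ^+ 3)
     = X / (w - z0) by rewrite /X; field.
  by rewrite nmM nmV ler_pdivrMr// -mulrA -exprSr.
have gT w : cball z0 r w -> exists b c, taylor g w (g w) b c 0 2.
  move=> wr; have [->|/eqP wz] := eqVneq w z0; first by exists b, c.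
  exact: (holo_taylor2 oA gA).
have sr' w : nm (w - z0) <= s -> cball z0 r w by move=> h; exact: le_lt_trans sr.
have gc w : cball z0 r w -> clim (cn w) g (g w).
  by move=> /gT[b' [c' T']]; exact: taylor_clim T'.
have gM w : nm (w - z0) <= s -> nm (g w) <= M / s.
  apply: max_nm => // [v /sr'/gc//|v vs|v vs].
    by apply/gT/sr'/ltW.
  have vz : v != z0 by apply: contraTneq s0 => E; rewrite -vs E subrr nm0 ltxx.
  rewrite /g (negbTE vz) nmM nmV vs ler_pM2r ?invr_gt0//.
  by apply/fM/sr'; rewrite vs.
have [->|zz] := eqVneq z z0; first by rewrite f0 subrr nm0 mulr0.
have n0 : 0 < nm (z - z0) by rewrite nm_gt0 subr_eq0.
by have := gM z zs; rewrite /g (negbTE zz) nmM nmV ler_pdivrMr.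
Qed.

Lemma schwarz f z0 (r s M : R) : 0 < s -> s < r -> holo (cball z0 r) f ->
  (forall z, cball z0 r z -> nm (f z) <= M) ->
  forall z, nm (z - z0) <= s -> nm (f z - f z0) <= 2 * M / s * nm (z - z0).
Proof.
move=> s0 sr hf fM; have o1 := @opn_cball R z0 r.
have z0r : cball z0 r z0 by rewrite /cball /= subrr nm0 (lt_trans s0).
apply: (@schwarz0 (fun z => f z - f z0) z0 r s (2 * M)) => //.
- by apply: holoB => //; exact: holo_cst.
- by rewrite subrr.
- move=> z zr; apply: (le_trans (ler_nmB _ _)).
  by have := fM z zr; have := fM z0 z0r; lra.
Qed.

(** The Schwarz lemma is centred at [w]: the disk of radius [r * 3 / 4] around [w] lies in the given
    one and [z] is within [r / 2] of [w], whence the constant [2 * M / (r / 2)]. *)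
Lemma holo_lipschitz f z0 (r M : R) : 0 < r -> holo (cball z0 r) f ->
  (forall z, cball z0 r z -> nm (f z) <= M) ->
  forall z w, nm (z - z0) <= r / 4 -> nm (w - z0) <= r / 4 ->
    nm (f z - f w) <= 4 * M / r * nm (z - w).
Proof.
move=> r0 hf fM z w zr wr.
have sub : cball w (r * 3 / 4) `<=` cball z0 r.
  move=> v; rewrite /cball /= => vw; have := ler_nmD (v - w) (w - z0).
  by rewrite subrKA; lra.
have -> : 4 * M / r = 2 * M / (r / 2) by field; rewrite gt_eqF.
apply: (@schwarz f w (r * 3 / 4)).
- by rewrite divr_gt0.
- by lra.
- exact: holo_sub sub hf.
- by move=> v /sub; exact: fM.
- by have := ler_nmD (z - z0) (z0 - w); rewrite subrKA (nmC z0); lra.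
Qed.

Lemma cauchy_deriv f z d (K : R) : is_cd f z d ->
  (\forall w \near cn z, nm (f w - f z) <= K * nm (w - z)) -> nm d <= K.
Proof.
move=> /is_cdP fd [r r0 Hr]; apply/ler_addgt0Pr => e e0.
have [s s0 Hs] := fd e e0.
pose t := Num.min r s / 2; have t0 : 0 < t by rewrite divr_gt0// lt_min r0 s0.
have tm : t < Num.min r s by rewrite /t ltr_pdivrMr ?ltr_pMr ?ltr1n// lt_min r0 s0.
move: tm; rewrite lt_min => /andP[tr ts].
have E : z + t%:C%C - z = t%:C%C by rewrite addrC addKr.
have := Hr (z + t%:C%C); have := Hs (z + t%:C%C).
rewrite E nm_real gtr0_norm// => /(_ ts) h1 /(_ tr) h2.
rewrite -(ler_pM2r t0) mulrDl.
have -> : nm d * t = nm (d * t%:C%C) by rewrite nmM nm_real gtr0_norm.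
set a := f _ - _ in h1 h2.
by have := ler_nmB a (a - d * t%:C%C); rewrite opprB addrC subrK; lra.
Qed.

End Schwarz.

(** * Normal families *)

Section NormalFamilies.
Variable R : realType.
Local Notation C := R[i].
Implicit Types (f g : C -> C) (z w : C) (A : set C) (F G : nat -> C -> C).

(** An ultrafilter converges to each of its cluster points, and compactness of the closed disk
    supplies one. *)
Lemma ultra_clim (U : set_system nat) (c : nat -> C) (M : R) : UltraFilter U ->
  (forall n, nm (c n) <= M) -> exists l, clim U c l.
Proof.
move=> UU cM; pose h n := (complex.Re (c n), complex.Im (c n)).
have hE n : Complex (h n).1 (h n).2 = c n by rewrite /h /=; case: (c n).
have [|p [_ pc]] := @compact_disc R 0 M (h @ U) _.
  apply: (@filterE nat U) => n; change (nm (Complex (h n).1 (h n).2 - 0) <= M).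
  by rewrite hE subr0.
exists (Complex p.1 p.2) => e e0.
have nb := @nbhs_cn R p _ (cn_ball (Complex p.1 p.2) e0).
have [//|FA] := in_ultra_setVsetC [set n | nm (c n - Complex p.1 p.2) < e] UU.
have FS : (h @ U) [set q | ~ nm (Complex q.1 q.2 - Complex p.1 p.2) < e].
  apply: (@filterS nat U _ _ _ _ FA) => n nA.
  by change (~ nm (Complex (h n).1 (h n).2 - Complex p.1 p.2) < e); rewrite hE.
by have [q [/= nq /nq]] := pc _ _ FS nb.
Qed.

Definition locally_bounded A F := forall a, A a -> exists r M : R,
  [/\ 0 < r, cball a r `<=` A & forall i z, cball a r z -> nm (F i z) <= M].

Section Family.
Variable A : set C.
Hypothesis oA : opn A.

Lemma locally_lipschitz F : (forall i, holo A (F i)) -> locally_bounded A F ->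
  forall a, A a -> exists r L : R, [/\ 0 < r, cball a r `<=` A &
    forall i z w, cball a r z -> cball a r w -> nm (F i z - F i w) <= L * nm (z - w)].
Proof.
move=> hF lF a /lF[r [M [r0 rA FM]]].
have sub z : cball a (r / 4) z -> nm (z - a) <= r / 4 by move/ltW.
exists (r / 4), (4 * M / r); split; first by rewrite divr_gt0.
  by move=> z /sub h; apply: rA; rewrite /cball /=; lra.
move=> i z w /sub zr /sub wr; apply: (@holo_lipschitz R (F i) a) => //.
  exact: holo_sub rA (hF i).
by move=> v; exact: FM.
Qed.

Lemma locally_bounded_deriv F G : (forall i, holo A (F i)) -> locally_bounded A F ->
  (forall i z, A z -> is_cd (F i) z (G i z)) -> locally_bounded A G.
Proof.
move=> hF lF FG a /(locally_lipschitz hF lF)[r [L [r0 rA FL]]].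
exists r, L; split => // i z zr; apply: cauchy_deriv (FG i z (rA _ zr)) _.
by apply: filterS (opn_cball zr) => w wr; exact: FL.
Qed.

Variable U : set_system nat.
Hypothesis UU : UltraFilter U.

(** Bounds on [F] pass to [G], and then make [G] locally Lipschitz with a constant [L] independent
    of the index. So the remainder of [F i] at [z] is at most [L * nm (w - z) ^+ 2], an inequality
    that survives a pointwise limit. *)
Lemma limit_deriv F G f g : (forall i, holo A (F i)) -> locally_bounded A F ->
  (forall i z, A z -> is_cd (F i) z (G i z)) -> (forall i, holo A (G i)) ->
  (forall z, A z -> clim U (F ^~ z) (f z)) ->
  (forall z, A z -> clim U (G ^~ z) (g z)) ->
  forall z, A z -> is_cd f z (g z).
Proof.
move=> hF lF FG hG fl gl z Az.
have [r [L [r0 rA GL]]] := locally_lipschitz hG (locally_bounded_deriv hF lF FG) Az.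
have zr : cball z r z by rewrite /cball /= subrr nm0.
have K i w : cball z r w ->
    nm (F i w - F i z - G i z * (w - z)) <= L * nm (w - z) * nm (w - z).
  move=> wr; have sw (t : R) : 0 <= t <= 1 -> nm (seg z w t - z) <= nm (w - z).
    by case/andP=> t0 t1; rewrite nm_seg ger0_norm// ler_piMl// nm_ge0.
  have sr (t : R) : 0 <= t <= 1 -> cball z r (seg z w t).
    by move/sw => h; exact: le_lt_trans wr.
  have L0 : 0 <= L * nm (w - z).
    by apply: le_trans (GL i w z wr zr); exact: nm_ge0.
  have -> : F i w - F i z - G i z * (w - z)
    = (F i w - G i z * w) - (F i z - G i z * z) by ring.
  apply: (@mean_value_le _ (fun v => F i v - G i z * v) (fun v => G i v - G i z)).
    move=> t /sr tr; have h1 := is_cdZ (- G i z) (is_cd_id (seg z w t)).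
    apply: is_cd_eq.
      apply: is_cd_near (is_cdD (FG i _ (rA _ tr)) h1).
      by apply: nearW => v; rewrite mulNr.
    by rewrite mulr1.
  move=> t t01; apply: (le_trans (GL i _ _ (sr t t01) zr)).
  have [->|wz] := eqVneq w z.
    by rewrite /seg subrr mulr0 addr0 subrr nm0 !mulr0.
  have n0 : 0 < nm (w - z) by rewrite nm_gt0 subr_eq0.
  have L1 : 0 <= L by rewrite -(pmulr_lge0 _ n0).
  by rewrite ler_wpM2l// sw.
have K' w : cball z r w -> nm (f w - f z - g z * (w - z)) <= L * nm (w - z) * nm (w - z).
  move=> wr; apply: (@clim_nm_le _ _ U _ (fun i => F i w - F i z - G i z * (w - z))).
    apply: climB; first by apply: climB; [exact/fl/rA|exact: fl].
    by apply: climM; [exact: gl|exact: clim_cst].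
  by apply: nearW => i; exact: K.
apply/is_cdP => e e0; have L1 : 0 < 1 + `|L| by rewrite ltr_pwDl.
apply: filterS2 (cn_ball z (divr_gt0 e0 L1)) (cn_ball z r0) => w h wr.
apply: (le_trans (K' w wr)); rewrite ler_wpM2r ?nm_ge0//.
move: h; rewrite ltr_pdivlMr// => /ltW; apply: le_trans.
rewrite mulrC ler_wpM2l ?nm_ge0//; have := ler_norm L; lra.
Qed.

Lemma limit_hol n F f : (forall i, holo A (F i)) -> locally_bounded A F ->
  (forall z, A z -> clim U (F ^~ z) (f z)) -> hol n A f.
Proof.
elim: n F f => //= n IH F f hF lF fl.
have /choice[G HG] : forall i, exists g, (forall z, A z -> is_cd (F i) z (g z)) /\ holo A g.
  by move=> i; have [g ? ?] := holo_deriv oA (hF i); exists g.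
have FG i z : A z -> is_cd (F i) z (G i z) by case: (HG i) => h _; exact: h.
have hG i : holo A (G i) by case: (HG i).
have lG := locally_bounded_deriv hF lF FG.
have /choice[g gl] : forall z, exists l, A z -> clim U (G ^~ z) l.
  move=> z; have [/lG[r [M [r0 rA GM]]]|nA] := pselect (A z); last by exists 0.
  have [i|l hl] := @ultra_clim U (G ^~ z) M UU; last by exists l.
  by apply: GM; rewrite /cball /= subrr nm0.
by exists g; [exact: limit_deriv lF FG hG fl gl|exact: IH gl].
Qed.

Lemma limit_holo F f : (forall i, holo A (F i)) -> locally_bounded A F ->
  (forall z, A z -> clim U (F ^~ z) (f z)) -> holo A f.
Proof. by move=> hF lF fl n; exact: limit_hol fl. Qed.

End Family.
End NormalFamilies.

(** * Continuous square roots *)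

Section SquareRootOnSquare.
Variable R : realType.
Local Notation C := R[i].
Implicit Types (z w u : C) (t : R) (p q : R * R).

Lemma Re_sqrtc_gt0 u : 0 < complex.Re u -> 0 < complex.Re (sqrtc u).
Proof.
move=> u0; have s0 : 0 <= complex.Re (sqrtc u).
  by case: u {u0} => a b; rewrite /sqrtc /= sqrtr_ge0.
rewrite lt_def s0 andbT; apply: contraTneq u0 => E; rewrite -leNgt.
by rewrite -(sqr_sqrtc u) expr2 Re_mul E mul0r sub0r oppr_le0 -expr2 sqr_ge0.
Qed.

(** The difference of two roots is the difference of their squares divided by their sum, and the
    real part of the sum is at least that of [sqrtc u]. *)
Lemma sqrtc_clim u : 0 < complex.Re u -> clim (cn u) (@sqrtc R) (sqrtc u).
Proof.
move=> u0; have s0 := Re_sqrtc_gt0 u0; set K := complex.Re (sqrtc u) in s0.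
apply: (@clim_le _ _ _ _ _ _ K^-1) => e e0 _.
apply: filterS2 (cn_ball u e0) (cn_ball u u0) => w we wu.
have w0 : 0 < complex.Re w.
  have := Re_le (u - w); rewrite nmC Re_sub; lra.
have sw := Re_sqrtc_gt0 w0.
have K1 : K <= nm (sqrtc w + sqrtc u).
  apply: le_trans (Re_le _); rewrite Re_add -/K; lra.
rewrite mulrC ler_pdivlMr//; apply: le_trans (ltW we).
rewrite -{2}(sqr_sqrtc w) -{2}(sqr_sqrtc u) subr_sqr nmM.
by rewrite ler_wpM2l ?nm_ge0.
Qed.

Lemma Re_div_gt0 z w : nm (w - z) < nm z -> 0 < complex.Re (w / z).
Proof.
move=> h; have z0 : z != 0 by rewrite -nm_gt0 (le_lt_trans _ h)// nm_ge0.
have : nm (1 - w / z) < 1.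
  rewrite (_ : 1 - w / z = (z - w) / z); last by field.
  by rewrite nmM nmV ltr_pdivrMr ?nm_gt0// mul1r nmC.
by move/(le_lt_trans (Re_le _)); rewrite Re_sub /=; lra.
Qed.

Definition continuousC (T : topologicalType) (f : T -> C) :=
  forall x, clim (nbhs x) f (f x).

Lemma clim_continuous (T S : topologicalType) (f : S -> C) (h : T -> S) x l :
  {for x, continuous h} -> clim (nbhs (h x)) f l -> clim (nbhs x) (f \o h) l.
Proof. by move=> hx fx e /fx/hx. Qed.

Section Square.
Variable F : R * R -> C.
Hypotheses (Fc : continuousC F) (F0 : forall p, F p != 0).

Let K : set (R * R) := `[0, 1]%classic `*` `[0, 1]%classic.

(** A Lebesgue number argument: near each point of the compact square, [F] moves by less than a
    quarter of its modulus there, which puts ratios of nearby values into the right half-plane. *)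
Lemma square_uniform : exists2 e : R, 0 < e & forall p q, K p ->
  `|q.1 - p.1| < e -> `|q.2 - p.2| < e -> 0 < complex.Re (F q / F p).
Proof.
have cK : compact K by apply: compact_setX; exact: segment_compact.
move/compact_near_coveringP : cK => /(_ R 0^'+ (fun e p => forall q,
  `|q.1 - p.1| < e -> `|q.2 - p.2| < e -> 0 < complex.Re (F q / F p)) _)[].
  move=> p Kp; have n0 : 0 < nm (F p) / 4 by rewrite divr_gt0// nm_gt0.
  have /nbhs_ballP[d /= d0 Hd] := Fc p n0.
  exists (ball p (d / 2), [set e | e < d / 2]) => /=.
    split; first by apply: nbhsx_ballx; rewrite divr_gt0.
    by apply: nbhs_right_lt; rewrite divr_gt0.
  move=> [q e] [/= [/= q1 q2] ed] v v1 v2.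
  have hq : nm (F q - F p) < nm (F p) / 4.
    apply: Hd; split; [apply: le_ball q1|apply: le_ball q2];
      by rewrite ler_pdivrMr// ler_pMr// ler1n.
  have hv : nm (F v - F p) < nm (F p) / 4.
    apply: Hd; rewrite /ball /= in q1 q2; split; rewrite /ball /=.
      by have := ler_distD q.1 p.1 v.1; rewrite (distrC q.1 v.1); lra.
    by have := ler_distD q.2 p.2 v.2; rewrite (distrC q.2 v.2); lra.
  apply: Re_div_gt0; have := ler_nmD (F v - F p) (F p - F q).
  rewrite subrKA (nmC (F p)); have := ler_nm_dist (F p) (F q); rewrite (nmC (F p)); lra.
move=> e /= e0 H; have [d [d0 Hd]] : exists d : R, 0 < d /\ K `<=` (fun p => forall q,
    `|q.1 - p.1| < d -> `|q.2 - p.2| < d -> 0 < complex.Re (F q / F p)).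
  exists (e / 2); split; first by rewrite divr_gt0.
  apply: H; last by rewrite divr_gt0.
  by rewrite /= sub0r normrN gtr0_norm ?divr_gt0// ltr_pdivrMr// ltr_pMr// ltr1n.
by exists d => // p q /Hd; apply.
Qed.

Let scl (k : R) p : R * R := (k * p.1, k * p.2).

Let scl_continuous k p : {for p, continuous (scl k)}.
Proof.
have h1 : (fun q : R * R => k * q.1) @ p --> k * p.1.
  by apply: cvgM; [exact: cvg_cst|exact: cvg_fst].
have h2 : (fun q : R * R => k * q.2) @ p --> k * p.2.
  by apply: cvgM; [exact: cvg_cst|exact: cvg_snd].
exact: cvg_pair h1 h2.
Qed.

(* The square root of [F p] is reached from [F 0] by the ratios of [F] at
   consecutive points of a fine subdivision of the segment from [0] to [p]:
   each ratio has positive real part, where the principal root is continuous. *)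
Lemma sqrt_square : exists S : R * R -> C, forall p, K p ->
  S p ^+ 2 = F p /\ clim (nbhs p) S (S p).
Proof.
have [e e0 He] := square_uniform.
pose N := (Num.bound e^-1).+1; have N0 : 0 < N%:R :> R by rewrite ltr0n.
have Ne : N%:R^-1 < e.
  rewrite -[ltRHS]invrK ltf_pV2 ?posrE ?invr_gt0//.
  apply: lt_trans (archi_boundP _) _; first by rewrite invr_ge0 ltW.
  by rewrite ltr_nat.
pose P (j : nat) p := F (scl (j%:R / N%:R) p).
have Pd p j : K p -> (j < N)%N -> 0 < complex.Re (P j.+1 p / P j p).
  move=> [/=]; rewrite !in_itv /= => /andP[a0 a1] /andP[b0 b1] jN.
  have jN1 : j%:R / N%:R <= 1 :> R by rewrite ler_pdivrMr// mul1r ler_nat ltnW.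
  have jN0 : 0 <= j%:R / N%:R :> R by rewrite divr_ge0.
  have E x : 0 <= x -> x <= 1 -> `|j.+1%:R / N%:R * x - j%:R / N%:R * x| < e.
    move=> x0 x1; rewrite -mulrBl -mulrBl -natr1 addrAC subrr add0r mul1r.
    rewrite ger0_norm ?mulr_ge0 ?invr_ge0 ?(ltW N0)//.
    by apply: le_lt_trans Ne; rewrite ler_piMr// invr_ge0 ltW.
  apply: He => /=; [|exact: E|exact: E].
  by split; rewrite /= in_itv /= mulr_ge0//= mulr_ile1.
pose S n p := sqrtc (F (scl 0 p)) * \prod_(j < n) sqrtc (P j.+1 p / P j p).
have S2 n p : S n p ^+ 2 = P n p.
  elim: n => [|n IH]; first by rewrite /S big_ord0 mulr1 sqr_sqrtc /P mul0r.
  rewrite /S big_ord_recr mulrA -/(S n p) exprMn IH /= sqr_sqrtc mulrC divfK//.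
  exact: F0.
have Pc n p : clim (nbhs p) (P n) (P n p).
  exact: clim_continuous (@scl_continuous _ p) (Fc _).
have Sc n p : K p -> (n <= N)%N -> clim (nbhs p) (S n) (S n p).
  move=> Kp; elim: n => [|n IH] nN.
    have E q : S 0%N q = sqrtc (F (0, 0)).
      by rewrite /S big_ord0 mulr1 /scl !mul0r.
    rewrite E; apply: (@clim_near _ _ _ _ (fun=> sqrtc (F (0, 0)))).
      by apply: nearW => q; rewrite E.
    exact: clim_cst.
  have E q : S n.+1 q = S n q * sqrtc (P n.+1 q / P n q).
    by rewrite /S big_ord_recr mulrA.
  rewrite E; apply: (@clim_near _ _ _ _ (fun q => S n q * sqrtc (P n.+1 q / P n q))).
    by apply: nearW => q; rewrite E.
  apply: climM; first by apply: IH; exact: ltnW.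
  apply: (@clim_comp _ _ _ _ (fun q => P n.+1 q / P n q) _ (P n.+1 p / P n p)) => //.
    by apply: climM => //; apply: climV => //; exact: F0.
  by apply: sqrtc_clim; exact: Pd.
exists (S N) => p Kp; split; last exact: Sc.
by rewrite S2 /P divff ?gt_eqF// /scl !mul1r; case: (p).
Qed.

End Square.

(** The quotient of the two roots is continuous with values 1 and -1; if it were -1 at [b], its real
    part would vanish somewhere in between. *)
Lemma lift_unique (s1 s2 : R -> C) (a b : R) : a <= b ->
  (forall t, a <= t <= b -> clim (nbhs t) s1 (s1 t)) ->
  (forall t, a <= t <= b -> clim (nbhs t) s2 (s2 t)) ->
  (forall t, a <= t <= b -> s1 t ^+ 2 = s2 t ^+ 2) ->
  (forall t, a <= t <= b -> s2 t != 0) ->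
  s1 a = s2 a -> s1 b = s2 b.
Proof.
move=> ab c1 c2 E n0 Ea; have aab : a <= a <= b by rewrite lexx.
have bab : a <= b <= b by rewrite lexx ab.
have pm t : a <= t <= b -> s1 t / s2 t = 1 \/ s1 t / s2 t = -1.
  move=> tab; have := E t tab; have := n0 t tab => t0 /eqP; rewrite eqf_sqr.
  by case/orP => /eqP ->; [left|right]; rewrite ?mulNr divff.
have [q1|q1] := pm b bab.
  by move/(congr1 ( *%R^~ (s2 b))): q1; rewrite divfK ?n0// mul1r.
pose q t := complex.Re (s1 t / s2 t).
have qc : {within `[a, b], continuous q}.
  apply: continuous_in_subspaceT => t /set_mem /=; rewrite in_itv /= => tab.
  apply/cvgrPdist_lt => e e0.
  have : clim (nbhs t) (fun t => s1 t / s2 t) (s1 t / s2 t).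
    by apply: climM; [exact: c1|apply: climV; [exact: c2|exact: n0]].
  move/(_ e e0); apply: filterS => u; rewrite /q -Re_sub nmC.
  exact: le_lt_trans (ler_Re _).
have qa : q a = 1 by rewrite /q Ea divff ?n0.
have qb : q b = -1 by rewrite /q q1.
have [|c cab qc0] := IVT (v := 0) ab qc.
  by rewrite qa qb ge_min le_max; apply/andP; split; apply/orP; [right|left]; lra.
move: cab; rewrite in_itv /= => /pm.
by move: qc0; rewrite /q => /eqP + [] E1; rewrite E1 /= ?oppr_eq0 oner_eq0.
Qed.

End SquareRootOnSquare.

(** * Lifting paths and homotopies through the square map *)

Section SquareRoot.
Variable R : realType.
Local Notation C := R[i].
Implicit Types (f g : C -> C) (z w : C) (A : set C) (t : R).

(** This retraction of the line onto the unit interval extends paths and homotopies to total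
    continuous maps, which avoids subspace topologies. *)
Definition clamp t : R := Num.min 1 (Num.max 0 t).

Lemma clamp01 t : 0 <= clamp t <= 1.
Proof. by rewrite /clamp le_min ge_min le_max !lexx ler01. Qed.

Lemma clamp_id t : 0 <= t <= 1 -> clamp t = t.
Proof. by case/andP=> t0 t1; rewrite /clamp max_r// min_r. Qed.

Lemma clamp_le0 t : t <= 0 -> clamp t = 0.
Proof. by move=> t0; rewrite /clamp max_l// min_r. Qed.

Lemma clamp_ge1 t : 1 <= t -> clamp t = 1.
Proof. by move=> t1; rewrite /clamp min_l// le_max t1 orbT. Qed.

Lemma clamp_dist s t : `|clamp s - clamp t| <= `|s - t|.
Proof.
have h1 := ler_norm (s - t); have h2 := ler_norm (t - s); rewrite distrC in h2.
rewrite /clamp !minEle !maxEle ler_norml.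
by do !case: ifPn; rewrite -?ltNge => *; apply/andP; split; lra.
Qed.

Lemma clamp_continuous : continuous clamp.
Proof.
move=> t; apply/cvgrPdist_lt => e e0; apply/nbhs_ballP; exists e => // s.
exact: le_lt_trans (clamp_dist _ _).
Qed.

Lemma clamp_affine_continuous (a b : R) : continuous (fun t => clamp (a * t + b)).
Proof.
move=> t; apply: (@continuous_comp _ _ _ (fun t => a * t + b) clamp).
  by apply: cvgD; [apply: cvgM; [exact: cvg_cst|exact: cvg_id]|exact: cvg_cst].
exact: clamp_continuous.
Qed.

Lemma clim_affine (s : R -> C) (a b : R) : continuousC s ->
  continuousC (fun t => s (clamp (a * t + b))).
Proof.
move=> sc t; exact: clim_continuous (@clamp_affine_continuous a b t) (sc _).
Qed.

(* Concatenation without case distinction: at each time one of the two clamped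
   terms is frozen at the junction point. *)
Definition pcat (s1 s2 : R -> C) t : C :=
  s1 (clamp (2 * t + 0)) + s2 (clamp (2 * t + (-1))) - s2 0.

Lemma pcat_continuous s1 s2 : continuousC s1 -> continuousC s2 ->
  continuousC (pcat s1 s2).
Proof.
move=> c1 c2 t; apply: climB; last exact: clim_cst.
by apply: climD; exact: clim_affine.
Qed.

Lemma pcatl s1 s2 t : t <= 2^-1 -> pcat s1 s2 t = s1 (clamp (2 * t)).
Proof.
move=> t2; rewrite /pcat addr0 (@clamp_le0 (_ + -1)) ?addrK//.
by rewrite subr_le0 -ler_pdivlMl// mulr1.
Qed.

Lemma pcatr s1 s2 t : s1 1 = s2 0 -> 2^-1 <= t ->
  pcat s1 s2 t = s2 (clamp (2 * t - 1)).
Proof.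
move=> E t2; rewrite /pcat addr0 (@clamp_ge1 (2 * t)) ?E 1?addrC ?addKr//.
by rewrite -ler_pdivrMl// mulr1.
Qed.

Lemma pcat_mono (s1 s2 : R -> C) (P : C -> Prop) : s1 1 = s2 0 ->
  (forall t, P (s1 t)) -> (forall t, P (s2 t)) -> forall t, P (pcat s1 s2 t).
Proof.
move=> E P1 P2 t; case: (leP t 2^-1) => [/pcatl->//|/ltW/pcatr->//].
Qed.

Lemma pcat0 s1 s2 : pcat s1 s2 0 = s1 0.
Proof. by rewrite pcatl ?mulr0 ?clamp_id ?lexx ?ler01 ?invr_ge0//. Qed.

Lemma pcat1 s1 s2 : s1 1 = s2 0 -> pcat s1 s2 1 = s2 1.
Proof.
move=> E; rewrite pcatr//; last by lra.
by rewrite (_ : 2 * 1 - 1 = 1)//; [rewrite clamp_id ?lexx ?ler01|ring].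
Qed.

Lemma pair_continuousr (a b : R) : {for b, continuous (fun t => (a, t))}.
Proof.
have h1 : (fun=> a) @ b --> a by exact: cvg_cst.
have h2 : id @ b --> b by exact: cvg_id.
exact: cvg_pair h1 h2.
Qed.

Lemma pair_continuousl (a b : R) : {for a, continuous (fun t => (t, b))}.
Proof.
have h1 : (fun=> b) @ a --> b by exact: cvg_cst.
have h2 : id @ a --> a by exact: cvg_id.
exact: cvg_pair h2 h1.
Qed.

(** The form of [loops_contractible] for total maps: continuity and values in [A] are global, while
    the boundary conditions concern the unit square. *)
Definition loops_null A : Prop := forall gm : R -> C,
  continuousC gm -> (forall t, A (gm t)) -> gm 0 = gm 1 ->
  exists H : R * R -> C, [/\ continuousC H, forall p, A (H p),
    forall t, 0 <= t <= 1 -> H (0, t) = gm t,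
    forall t, 0 <= t <= 1 -> H (1, t) = gm 0 &
    forall s : R, 0 <= s <= 1 -> H (s, 0) = gm 0 /\ H (s, 1) = gm 0].

(** Connectedness as an induction principle: a property that holds somewhere in [A], and that is
    locally stable together with its negation, holds on all of [A]. *)
Definition cnn A : Prop := forall P : C -> Prop, (exists2 z, A z & P z) ->
  (forall z, A z -> P z -> \forall w \near cn z, A w -> P w) ->
  (forall z, A z -> ~ P z -> \forall w \near cn z, A w -> ~ P w) ->
  forall z, A z -> P z.

Section Lift.
Variables (A : set C) (f : C -> C) (z0 w0 : C).
Hypotheses (oA : opn A) (fc : forall z, A z -> clim (cn z) f (f z)).
Hypotheses (f0 : forall z, A z -> f z != 0).

(** The graph of the root under construction: [w] is the value at [z] obtained by continuing the
    root [w0] at [z0] along some path in [A]. *)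
Definition lifts z w : Prop := exists gm s : R -> C,
  [/\ continuousC gm, continuousC s, forall t, A (gm t),
      forall t, s t ^+ 2 = f (gm t) &
      [/\ gm 0 = z0, gm 1 = z, s 0 = w0 & s 1 = w]].

Lemma local_ratio c : A c -> exists r : R, [/\ 0 < r, cball c r `<=` A &
  forall z, cball c r z -> 0 < complex.Re (f z / f c)].
Proof.
move=> Ac; have n0 : 0 < nm (f c) by rewrite nm_gt0 f0.
have [r r0 Hr] := filterI (oA Ac) (fc Ac n0).
exists r; split => // z /Hr[]// _; exact: Re_div_gt0.
Qed.

Section Step.
Variables (c : C) (r : R).
Hypotheses (rA : cball c r `<=` A).
Hypothesis ratio : forall z, cball c r z -> 0 < complex.Re (f z / f c).

Let sg z := sqrtc (f z / f c).

Lemma cball_seg z1 z2 t : cball c r z1 -> cball c r z2 -> 0 <= t <= 1 ->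
  cball c r (seg z1 z2 t).
Proof.
rewrite /cball /= => h1 h2 /andP[t0 t1].
have -> : seg z1 z2 t - c = (1 - t)%:C%C * (z1 - c) + t%:C%C * (z2 - c).
  by rewrite /seg rmorphB rmorph1 /=; ring.
apply: (le_lt_trans (ler_nmD _ _)); rewrite !nmM !nm_real !ger0_norm ?subr_ge0//.
have [->|tn] := eqVneq t 0; first by rewrite mul0r subr0 mul1r addr0.
have tp : 0 < t by rewrite lt_def tn.
have : (1 - t) * nm (z1 - c) <= (1 - t) * r by rewrite ler_wpM2l ?subr_ge0// ltW.
have : t * nm (z2 - c) < t * r by rewrite ltr_pM2l.
by lra.
Qed.

Lemma sg_clim z : cball c r z -> clim (cn z) sg (sg z).
Proof.
move=> zr; apply: (@clim_comp _ _ _ _ (fun z => f z / f c) _ (f z / f c)) => //.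
  by apply: climM; [exact/fc/rA|exact: clim_cst].
by apply: sqrtc_clim; exact: ratio.
Qed.

Lemma sg_neq0 z : cball c r z -> sg z != 0.
Proof.
move=> /ratio/Re_sqrtc_gt0; apply: contraTneq; rewrite /sg => ->.
by rewrite ltxx.
Qed.

(** The path is prolonged by the segment from [z1] to [z2], on which a rescaled principal root of
    [f z / f c] continues the lift. As neither end has to be the centre, the step leads out of the
    centre as well as back to it. *)
Lemma lifts_step z1 z2 w : cball c r z1 -> cball c r z2 -> lifts z1 w ->
  lifts z2 (w * sg z2 / sg z1).
Proof.
move=> h1 h2 [gm [s [gc sc gA sg2 [g0 g1 s0 s1]]]].
have cr : cball c r c.
  by rewrite /cball /= subrr nm0; apply: le_lt_trans h1; exact: nm_ge0.
pose gm' t := seg z1 z2 (clamp t).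
pose s' t := w * sg (gm' t) / sg z1.
have gr t : cball c r (gm' t) by apply: cball_seg => //; exact: clamp01.
have gm'c : continuousC gm'.
  move=> t; rewrite /gm' /seg; apply: climD; first exact: clim_cst.
  apply: climM; last exact: clim_cst.
  move=> e e0; apply: filterS (@nbhsx_ballx _ _ t e e0) => u /=.
  rewrite /ball /= -rmorphB nm_real => h.
  by apply: le_lt_trans (clamp_dist _ _) _; rewrite distrC.
have s'c : continuousC s'.
  move=> t; apply: climM; last exact: clim_cst.
  apply: climM; first exact: clim_cst.
  by apply: (@clim_comp _ _ _ _ gm' sg (gm' t)) => //; exact: sg_clim.
have e0 : gm 1 = gm' 0 by rewrite g1 /gm' clamp_id ?lexx ?ler01// seg0.
have e1 : s 1 = s' 0 by rewrite s1 /s' -e0 g1 mulfK// sg_neq0.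
exists (pcat gm gm'), (pcat s s'); split.
- exact: pcat_continuous.
- exact: pcat_continuous.
- by apply: pcat_mono => // t; exact: rA.
- move=> t; case: (leP t 2^-1) => [t2|/ltW t2]; first by rewrite !pcatl.
  rewrite !pcatr// /s'; set v := gm' _.
  rewrite !exprMn exprVn /sg !sqr_sqrtc -s1 sg2 g1.
  by field; rewrite !f0//; exact: rA.
- by rewrite !pcat0 !pcat1// /s' /gm' clamp_id ?lexx ?ler01// seg1.
Qed.
End Step.

(** Reachability is locally stable by steps out of the centre of a small ball, unreachability by
    steps back to the centre. *)
Lemma lifts_exist : cnn A -> A z0 -> w0 ^+ 2 = f z0 ->
  forall z, A z -> exists w, lifts z w.
Proof.
move=> cA Az0 w02; apply: cA.
- exists z0 => //; exists w0, (fun=> z0), (fun=> w0).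
  by split => // t; exact: clim_cst.
- move=> z Az [w zw]; have [r [r0 rA rat]] := local_ratio Az.
  exists r => // v vr _; eexists; apply: (lifts_step rA rat _ vr zw).
  by rewrite /cball /= subrr nm0.
- move=> z Az nz; have [r [r0 rA rat]] := local_ratio Az.
  exists r => // v vr _ [w zw]; apply: nz; eexists; apply: (lifts_step rA rat vr _ zw).
  by rewrite /cball /= subrr nm0.
Qed.

(** The first path followed by the reverse of the second is a loop. A root of [f] along its null
    homotopy is constant on the three sides mapped to [z0]; on the fourth side it follows [s1] from
    one end and [s2] from the other, and they meet at the midpoint. *)
Lemma lifts_unique z w w' : loops_null A -> lifts z w -> lifts z w' -> w = w'.
Proof.
move=> nA [g1 [s1 [gc1 sc1 gA1 sg1 [g10 g11 s10 s11]]]].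
move=> [g2 [s2 [gc2 sc2 gA2 sg2 [g20 g21 s20 s21]]]].
pose g2' t := g2 (clamp ((-1) * t + 1)).
have cl t : 0 <= t <= 1 -> clamp ((-1) * t + 1) = 1 - t.
  by move=> t01; rewrite mulN1r addrC clamp_id//; lra.
have E : g1 1 = g2' 0 by rewrite /g2' cl ?lexx ?ler01// subr0 g11 g21.
have E1 : g2' 1 = z0 by rewrite /g2' cl ?lexx ?ler01// subrr g20.
have [|||H [Hc HA H0 H1 Hs]] := nA (pcat g1 g2').
- by apply: pcat_continuous => //; exact: clim_affine.
- by apply: pcat_mono => // t; exact: gA2.
- by rewrite pcat0 pcat1// E1 g10.
have Fc : continuousC (f \o H).
  move=> p; apply: clim_comp (Hc p) _ _ => //; exact: fc.
have [|S HS] := sqrt_square Fc; first by move=> p; exact/f0.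
have F0 p : (f \o H) p != 0 by exact: f0.
have z00 : pcat g1 g2' 0 = z0 by rewrite pcat0 g10.
have w02 : w0 ^+ 2 = f z0 by rewrite -s10 sg1 g10.
have w00 : w0 != 0 by rewrite -(sqrf_eq0 w0) w02 -g10 f0.
have i0 : (0 : R) \in `[0, 1] by rewrite in_itv /= lexx ler01.
have S00 : S (0, 0) ^+ 2 = w0 ^+ 2.
  have [|-> _] := HS (0, 0); first by split.
  by rewrite /= H0 ?lexx ?ler01// z00 w02.
have S0n : S (0, 0) != 0 by rewrite -(sqrf_eq0 (S _)) S00 sqrf_eq0.
(* The factor is a sign, chosen to make the root equal [w0] at the corner. *)
pose T p := w0 / S (0, 0) * S p.
have T00 : T (0, 0) = w0 by rewrite /T divfK.
have T2 (a b : R) : 0 <= a <= 1 -> 0 <= b <= 1 -> T (a, b) ^+ 2 = f (H (a, b)).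
  move=> a01 b01; rewrite /T exprMn exprMn exprVn S00 divff ?sqrf_eq0// mul1r.
  by have [|-> _] := HS (a, b); first by split; rewrite /= in_itv.
have Tc (a b : R) : 0 <= a <= 1 -> 0 <= b <= 1 -> clim (nbhs (a, b)) T (T (a, b)).
  move=> a01 b01; apply: climM; first exact: clim_cst.
  by have [|_ ] := HS (a, b); first by split; rewrite /= in_itv.
have Tc1 (a b : R) : 0 <= a <= 1 -> 0 <= b <= 1 ->
    clim (nbhs b) (fun t => T (a, t)) (T (a, b)).
  move=> a01 b01.
  apply: (@clim_continuous _ _ _ T (fun t : R => (a, t)) b _ _ (Tc a b a01 b01)).
  exact: pair_continuousr.
have Tc2 (a b : R) : 0 <= a <= 1 -> 0 <= b <= 1 ->
    clim (nbhs a) (fun t => T (t, b)) (T (a, b)).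
  move=> a01 b01.
  apply: (@clim_continuous _ _ _ T (fun t : R => (t, b)) a _ _ (Tc a b a01 b01)).
  exact: pair_continuousl.
have u0 : 0 <= (0 : R) <= 1 by rewrite lexx ler01.
have u1 : 0 <= (1 : R) <= 1 by rewrite lexx ler01.
(* The value [w0] is carried around the three constant sides, through [(1, 0)] and [(1, 1)] to
   [(0, 1)]. *)
have T10 : T (1, 0) = w0.
  apply: (@lift_unique _ (fun t => T (t, 0)) (fun=> w0) 0 1) => // t t01.
  - exact: Tc2.
  - exact: clim_cst.
  - by rewrite T2// (Hs t t01).1 z00 w02.
have T11 : T (1, 1) = w0.
  apply: (@lift_unique _ (fun t => T (1, t)) (fun=> w0) 0 1) => // t t01.
  - exact: Tc1.
  - exact: clim_cst.
  - by rewrite T2// H1// z00 w02.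
have T01 : T (0, 1) = w0.
  have T012 : T (0, 1) ^+ 2 = w0 ^+ 2 by rewrite T2// (Hs 0 u0).2 z00 w02.
  rewrite -T11; symmetry.
  apply: (@lift_unique _ (fun t => T (t, 1)) (fun=> T (0, 1)) 0 1) => // t t01.
  - exact: Tc2.
  - exact: clim_cst.
  - by rewrite T2// T012 (Hs t t01).2 z00 w02.
  - by rewrite -(sqrf_eq0 (T _)) T012 sqrf_eq0.
have h0 : 0 <= 2^-1 :> R by rewrite invr_ge0.
have half t : 0 <= t <= 2^-1 -> 0 <= t <= 1 by lra.
have c2 t : 0 <= t <= 2^-1 -> clamp (2 * t + 0) = 2 * t.
  by move=> ?; rewrite addr0 clamp_id//; lra.
have c1 : clamp (2 * 2^-1 + 0) = 1 by rewrite addr0 divff ?pnatr_eq0// clamp_id.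
have c3 : 1 - 2^-1 = 2^-1 :> R by lra.
have L : T (0, 2^-1) = w.
  rewrite -s11 (_ : s1 1 = s1 (clamp (2 * 2^-1 + 0))); last by rewrite c1.
  apply: (@lift_unique _ (fun t => T (0, t)) (fun t => s1 (clamp (2 * t + 0))) 0) => //.
  - by move=> t /half; exact: Tc1.
  - by move=> t _; exact: clim_affine.
  - move=> t th; have /andP[_ t2] := th.
    by rewrite T2// ?half// H0 ?half// pcatl// sg1 addr0.
  - by move=> t _; rewrite -(sqrf_eq0 (s1 _)) sg1 f0.
  - by rewrite T00 mulr0 add0r clamp_id.
(* Read backwards from [(0, 1)], the second half of the loop runs through [g2] in its own direction,
   and the root starts from [w0] as [s2] does. *)
have L' : T (0, 2^-1) = w'.
  rewrite -s21 (_ : s2 1 = s2 (clamp (2 * 2^-1 + 0))); last by rewrite c1.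
  rewrite -[in T _]c3.
  apply: (@lift_unique _ (fun t => T (0, 1 - t)) (fun t => s2 (clamp (2 * t + 0))) 0 2^-1) => //.
  - move=> t th; have t01 : 0 <= 1 - t <= 1 by lra.
    apply: (@clim_continuous _ _ _ (fun t => T (0, t)) (fun t : R => 1 - t) t _ _
      (Tc1 0 (1 - t) u0 t01)).
    by apply: cvgB; [exact: cvg_cst|exact: cvg_id].
  - by move=> t _; exact: clim_affine.
  - move=> t th; have t01 : 0 <= 1 - t <= 1 by lra.
    rewrite T2// H0// pcatr//; last by lra.
    rewrite sg2 /g2' c2// (_ : 2 * (1 - t) - 1 = 1 - 2 * t); last by ring.
    by rewrite (@clamp_id (1 - _)) ?cl//; [congr (f (g2 _)); ring|lra|lra].
  - by move=> t _; rewrite -(sqrf_eq0 (s2 _)) sg2 f0.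
  - by rewrite subr0 T01 mulr0 add0r clamp_id.
by rewrite -L L'.
Qed.

End Lift.

Lemma sqrt_exists A f : opn A -> cnn A -> loops_null A ->
  (forall z, A z -> clim (cn z) f (f z)) -> (forall z, A z -> f z != 0) ->
  exists g, forall z, A z -> g z ^+ 2 = f z /\ clim (cn z) g (g z).
Proof.
move=> oA cA nA fc f0; have [[z0 Az0]|A0] := pselect (exists z, A z); last first.
  by exists id => z Az; case: A0; exists z.
pose w0 := sqrtc (f z0); have w02 : w0 ^+ 2 = f z0 by exact: sqr_sqrtc.
have /choice[g gl] : forall z, exists w, A z -> lifts A f z0 w0 z w.
  move=> z; have [Az|] := pselect (A z); last by exists 0.
  by have [w] := lifts_exist oA fc f0 cA Az0 w02 Az; exists w.
exists g => z Az; split.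
  by have [gm [s [_ _ _ sg [_ g1 _ s1]]]] := gl z Az; rewrite -s1 sg g1.
have [r [r0 rA rat]] := local_ratio oA fc f0 Az.
have zr : cball z r z by rewrite /cball /= subrr nm0.
pose sg v := sqrtc (f v / f z).
(* Uniqueness identifies the chosen values near [z] with an explicit expression in principal roots,
   which is continuous. *)
have E v : cball z r v -> g z * sg v / sg z = g v.
  move=> vr; apply: (lifts_unique fc f0 nA) (gl v (rA _ vr)).
  exact: (lifts_step fc f0 rA rat zr vr (gl z Az)).
apply: (@clim_near _ _ _ _ (fun v => g z * sg v / sg z)).
  by exists r => // v /E.
have H : clim (cn z) (fun v => g z * sg v / sg z) (g z * sg z / sg z).
  apply: climM; last exact: clim_cst.
  by apply: climM; [exact: clim_cst|exact: (sg_clim fc rA rat zr)].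
by rewrite E in H.
Qed.

Lemma loops_null_cball (c : C) (r : R) : loops_null (cball c r).
Proof.
move=> gm gc gA g01; pose H (p : R * R) := seg (gm p.2) (gm 0) (clamp p.1).
exists H; split.
- move=> p; have h2 : clim (nbhs p) (fun q : R * R => gm q.2) (gm p.2).
    by apply: (@clim_continuous _ _ _ gm snd p) => //; exact: cvg_snd.
  rewrite /H /seg; apply: climD => //.
  apply: climM; last by apply: climB => //; exact: clim_cst.
  apply: (@clim_continuous _ _ _ (fun t => t%:C%C) (fun q : R * R => clamp q.1) p).
    apply: continuous_comp; [exact: cvg_fst|exact: clamp_continuous].
  move=> e e0; apply: filterS (@nbhsx_ballx _ _ (clamp p.1) e e0) => u /=.
  by rewrite /ball /= -rmorphB nm_real distrC.
- by move=> p; apply: cball_seg => //; exact: clamp01.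
- by move=> t _; rewrite /H /= clamp_id ?lexx ?ler01// seg0.
- by move=> t _; rewrite /H /= clamp_id ?lexx ?ler01// seg1.
- by move=> s _; rewrite /H /= -g01 /seg subrr mulr0 addr0.
Qed.

(** Along a segment from a point with [P] to one without, the function equal to 1 or -1 according to
    [P] would be continuous and change sign without a zero. *)
Lemma cnn_cball (c : C) (r : R) : cnn (cball c r).
Proof.
move=> P [z zr Pz] Po Pc w wr; apply: contrapT => nPw.
pose chi t : R := if `[< P (seg z w t) >] then 1 else -1.
have sr t : t \in `[0, 1] -> cball c r (seg z w t).
  by rewrite in_itv; exact: cball_seg.
have sc (t : R) (Q : C -> Prop) : cn (seg z w t) Q -> \forall s \near t, Q (seg z w s).
  case=> e e0 He; have n1 : 0 < 1 + nm (w - z) by rewrite ltr_pwDl// nm_ge0.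
  apply/nbhs_ballP; exists (e / (1 + nm (w - z))); first by rewrite /= divr_gt0.
  move=> s; rewrite /ball /= distrC ltr_pdivlMr// => h; apply: He.
  rewrite segB nmM nm_real; apply: le_lt_trans h.
  by rewrite ler_wpM2l// lerDr.
have cc : {within `[0, 1], continuous chi}.
  apply: continuous_in_subspaceT => t /set_mem /= /sr tr.
  apply/cvgrPdist_lt => e e0; rewrite /chi.
  have oB := opn_cball tr.
  case: asboolP => Pt.
    have K : cn (seg z w t) P by apply: filterS2 oB (Po _ tr Pt) => v h /(_ h).
    apply: filterS (sc t _ K) => s Ps.
    by case: asboolP => // _; rewrite subrr normr0.
  have K : cn (seg z w t) (fun v => ~ P v).
    by apply: filterS2 oB (Pc _ tr Pt) => v h /(_ h).
  apply: filterS (sc t _ K) => s Ps.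
  by case: asboolP => // _; rewrite subrr normr0.
have c0 : chi 0 = 1 by rewrite /chi seg0; case: asboolP.
have c1 : chi 1 = -1 by rewrite /chi seg1; case: asboolP.
have [|t _ /eqP] := IVT (v := 0) ler01 cc.
  by rewrite c0 c1 ge_min le_max; apply/andP; split; apply/orP; [right|left]; lra.
by rewrite /chi; case: ifP; rewrite ?oppr_eq0 oner_eq0.
Qed.

Lemma holo_sqrt_exists A f : opn A -> cnn A -> loops_null A -> holo A f ->
  (forall z, A z -> f z != 0) ->
  exists2 g, holo A g & forall z, A z -> g z ^+ 2 = f z.
Proof.
move=> oA cA nA hf f0.
have [g Hg] := sqrt_exists oA cA nA (fun z => holo_cont oA hf) f0.
exists g => [|z /Hg[]//]; apply: holo_sqrt hf => // z /Hg[]//.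
Qed.

End SquareRoot.

(** * Hurwitz's theorem and Koebe's argument *)

Section Hurwitz.
Variable R : realType.
Local Notation C := R[i].
Implicit Types (f g h : C -> C) (z w b : C) (A : set C) (F : nat -> C -> C).

(* Taking square roots of [h] lowers [m] down to [0], where the Schwarz lemma
   suffices; the statement plays the role of Harnack's inequality for
   [- ln |h|]. *)
Lemma nonvanishing_small (b : C) (r : R) (m : nat) h : 0 < r ->
  holo (cball b r) h -> (forall z, cball b r z -> h z != 0) ->
  (forall z, cball b r z -> nm (h z) <= 1) -> nm (h b) <= 2^-1 ^+ (2 ^ m) ->
  forall z, nm (z - b) <= r / 16 -> nm (h z) <= (3 / 4) ^+ (2 ^ m).
Proof.
move=> r0; have bb : cball b r b by rewrite /cball /= subrr nm0.
elim: m h => [|m IH] h hh h0 h1 hb z zr.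
  (* The Schwarz constant is [4 / r], so within [r / 16] of [b] the function moves by at most 1/4
     from a value of modulus at most 1/2: hence 3/4. *)
  have r2 : 0 < r / 2 by rewrite divr_gt0.
  have r2r : r / 2 < r by lra.
  have zr2 : nm (z - b) <= r / 2 by lra.
  have := schwarz r2 r2r hh h1 zr2.
  rewrite (_ : 2 * 1 / (r / 2) = 4 / r); last by field; rewrite gt_eqF.
  have : 4 / r * nm (z - b) <= 4^-1.
    rewrite -(_ : 4 / r * (r / 16) = 4^-1); last by field; rewrite gt_eqF.
    by rewrite ler_pM2l// divr_gt0.
  have := ler_nm_dist (h z) (h b); move: hb; rewrite !expn0 !expr1; lra.
have o1 := @opn_cball R b r.
have [k hk k2] := holo_sqrt_exists o1 (@cnn_cball R b r) (@loops_null_cball R b r) hh h0.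
have nk v : cball b r v -> nm (k v) ^+ 2 = nm (h v) by move/k2 <-; rewrite nmX.
have k0 v : cball b r v -> k v != 0 by move=> vr; rewrite -(sqrf_eq0 (k v)) k2// h0.
have zb : cball b r z by rewrite /cball /=; lra.
rewrite -nk// expnSr exprM lerXn2r ?nnegrE ?nm_ge0 ?exprn_ge0//.
apply: (IH k hk k0 _ _ z zr).
  by move=> v vr; rewrite -(@ler_pXn2r _ 2) ?nnegrE ?nm_ge0// nk// expr1n h1.
rewrite -(@ler_pXn2r _ 2) ?nnegrE ?nm_ge0 ?exprn_ge0 ?invr_ge0//.
by rewrite nk// -exprM -expnSr.
Qed.

Lemma exp_small (x e : R) : 0 <= x -> x < 1 -> 0 < e -> exists m, x ^+ (2 ^ m) < e.
Proof.
move=> x0 x1 e0; have : (fun n => x ^+ n) @ \oo --> (0 : R).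
  by apply: cvg_expr; rewrite ger0_norm.
move/cvgrPdist_lt => /(_ e e0)[n _ /(_ n (leqnn n))]; rewrite sub0r normrN => h.
exists n; apply: le_lt_trans (le_lt_trans (ler_norm _) h).
apply: ler_wiXn2l => //; first exact: ltW.
by rewrite ltnW// ltn_expl.
Qed.

Variable U : set_system nat.
Hypothesis UU : UltraFilter U.

(** Half of [F i - u i] is nonvanishing, of modulus at most 1, and tends to 0 at [b];
    [nonvanishing_small] spreads this limit over the disk of radius [r / 16]. The omitted value may
    depend on [i], as the proof of injectivity requires. *)
Lemma hurwitz (b : C) (r : R) F f (u : nat -> C) : 0 < r ->
  (forall i, holo (cball b r) (F i)) ->
  (forall i z, cball b r z -> nm (F i z) <= 1) -> (forall i, nm (u i) <= 1) ->
  (forall i z, cball b r z -> F i z != u i) ->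
  (forall z, cball b r z -> clim U (F ^~ z) (f z)) -> clim U u (f b) ->
  forall z, nm (z - b) <= r / 16 -> f z = f b.
Proof.
move=> r0 hF F1 u1 Fu fl ul z zr.
have bb : cball b r b by rewrite /cball /= subrr nm0.
have zb : cball b r z by rewrite /cball /=; lra.
pose G i v := 2^-1 * (F i v - u i).
have n2 : nm (2^-1 : C) = 2^-1 by rewrite nmV nm2.
have GF v l : clim U (F ^~ v) l -> clim U (G ^~ v) (2^-1 * (l - f b)).
  by move=> h; apply: climM; [exact: clim_cst|exact: climB].
suff : clim U (G ^~ z) 0.
  move/(clim_unique (GF z (f z) (fl z zb)))/eqP.
  by rewrite mulf_eq0 invr_eq0 pnatr_eq0 /= subr_eq0 => /eqP.
move=> e e0; have [m me] := @exp_small (3 / 4) e ltac:(lra) ltac:(lra) e0.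
have d0 : 0 < 2^-1 ^+ (2 ^ m) :> R by rewrite exprn_gt0 ?invr_gt0.
have Gb : clim U (G ^~ b) 0.
  by rewrite -[0](mulr0 (2^-1)) -(subrr (f b)); exact: GF (fl b bb).
apply: filterS (Gb _ d0) => i; rewrite !subr0 => /ltW Gi.
apply: le_lt_trans me; apply: (@nonvanishing_small b r m (G i) r0 _ _ _ Gi z zr).
- apply: holoM; first exact: holo_cst.
  apply: holoB; [exact: opn_cball|exact: hF|exact: holo_cst].
- by move=> v vr; rewrite mulf_neq0// ?invr_eq0 ?pnatr_eq0// subr_eq0 Fu.
- move=> v vr; rewrite nmM n2; have := ler_nmB (F i v) (u i).
  by have := F1 i v vr; have := u1 i; lra.
Qed.

End Hurwitz.

(** * Automorphisms of the unit disk *)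

Section Moebius.
Variable R : realType.
Local Notation C := R[i].
Implicit Types (c z : C).

Definition mob c z : C := (z - c) / (1 - conjc c * z).

Lemma mob_den c z : nm c < 1 -> nm z < 1 -> 1 - conjc c * z != 0.
Proof.
move=> c1 z1; rewrite subr_eq0; apply/eqP => E.
have := nmM (conjc c) z; rewrite -E nm1 nm_conj => h.
by have := nm_ge0 c; have := nm_ge0 z; nra.
Qed.

Lemma mob_lt1 c z : nm c < 1 -> nm z < 1 -> nm (mob c z) < 1.
Proof.
move=> c1 z1; have d0 := mob_den c1 z1.
rewrite nmM nmV ltr_pdivrMr ?nm_gt0// mul1r.
rewrite -(@ltr_pXn2r _ 2) ?nnegrE ?nm_ge0//.
(* This product is the squared modulus of [1 - conjc c * z] minus that of [z - c]. *)
have : 0 < (1 - nm c ^+ 2) * (1 - nm z ^+ 2).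
  by rewrite mulr_gt0// subr_gt0 expr_lt1// nm_ge0.
rewrite !nm_sqr; case: c {c1 d0} => a b; case: z {z1} => x y /=.
by lra.
Qed.

Lemma mob_inj c z w : nm c < 1 -> nm z < 1 -> nm w < 1 -> mob c z = mob c w -> z = w.
Proof.
move=> c1 z1 w1 /eqP; rewrite eqr_div ?mob_den// => /eqP E.
have cc : 1 - c * conjc c != 0.
  by rewrite mulrC; exact: mob_den.
apply/(mulfI cc)/eqP; rewrite -subr_eq0; apply/eqP.
transitivity ((z - c) * (1 - conjc c * w) - (w - c) * (1 - conjc c * z)); first by ring.
by rewrite E subrr.
Qed.

Lemma mob_eq0 c z : nm c < 1 -> nm z < 1 -> (mob c z == 0) = (z == c).
Proof.
by move=> c1 z1; rewrite mulf_eq0 invr_eq0 (negbTE (mob_den c1 z1)) orbF subr_eq0.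
Qed.

End Moebius.

(** * The extremal problem for injective maps into the disk *)

Section RiemannMapping.
Variable R : realType.
Local Notation C := R[i].
Implicit Types (f g h : C -> C) (z w : C).
Variables (A : set C) (z0 : C).
Hypotheses (oA : opn A) (cA : cnn A) (nA : loops_null A) (Az0 : A z0).

Definition inj_on f := forall z w, A z -> A w -> f z = f w -> z = w.

Definition fam f := [/\ holo A f, forall z, A z -> nm (f z) < 1, inj_on f & f z0 = 0].

Lemma holo_mob g c : holo A g -> (forall z, A z -> nm (g z) < 1) -> nm c < 1 ->
  holo A (fun z => mob c (g z)).
Proof.
move=> hg g1 c1; rewrite /mob; apply: holoM; first by apply: holoB => //; exact: holo_cst.
apply: holoV; first by move=> z /g1; exact: mob_den.
by apply: holoB => //; [exact: holo_cst|apply: holoM => //; exact: holo_cst].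
Qed.

Lemma fam_mob g : holo A g -> (forall z, A z -> nm (g z) < 1) -> inj_on g ->
  fam (fun z => mob (g z0) (g z)).
Proof.
move=> hg g1 gi; split; first by apply: holo_mob => //; exact: g1.
- by move=> z Az; apply: mob_lt1; exact: g1.
- by move=> z w Az Aw /mob_inj H; apply: gi => //; apply: H; exact: g1.
- by apply/eqP; rewrite mob_eq0// g1.
Qed.

(** A root [k] of [z - a] never takes two opposite values. Taking the value [c] at [z0], it
    therefore stays away from [-c], and the inverse of [k + c], suitably scaled, maps into the
    disk. *)
Lemma fam_nonempty a : ~ A a -> exists f, fam f.
Proof.
move=> nAa.
have [|z Az|k hk k2] := holo_sqrt_exists (f := fun z => z - a) oA cA nA.
- by apply: holoB => //; [exact: holo_id|exact: holo_cst].
- by rewrite subr_eq0; apply/eqP => E; apply: nAa; rewrite -E.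
set c := k z0; have c0 : 0 < nm c.
  rewrite nm_gt0 -(sqrf_eq0 c) k2// subr_eq0.
  by apply/eqP => E; apply: nAa; rewrite -E.
have [r r0 Hr] := holo_cont oA hk Az0 c0.
(* If [k z] were within [d] of [-c], then [nm (k z - c)] would be below [3 * nm c], and the product
   [nm (z - z0)] of the two distances below [r]. Continuity then puts [k z] within [nm c] of [c],
   too far from [-c]. No open mapping theorem enters. *)
pose d := Num.min (nm c) (r / (4 * nm c)).
have d0 : 0 < d by rewrite lt_min c0 divr_gt0// mulr_gt0.
have far z : A z -> d <= nm (k z + c).
  move=> Az; rewrite leNgt; apply/negP => kd.
  have [d1 d2] : d <= nm c /\ d <= r / (4 * nm c) by rewrite /d !ge_min !lexx orbT.
  have kc : nm (k z - c) <= nm (k z + c) + 2 * nm c.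
    have := ler_nmB (k z + c) (2 * c); rewrite nmM nm2.
    by rewrite (_ : k z + c - 2 * c = k z - c)//; ring.
  have E : nm (z - z0) = nm (k z - c) * nm (k z + c).
    by rewrite -nmM -subr_sqr k2// k2//; congr nm; ring.
  have zr : nm (z - z0) < r.
    move: d2; rewrite ler_pdivlMr ?mulr_gt0// E => d2.
    have := nm_ge0 (k z + c); have := nm_ge0 (k z - c); nra.
  have := Hr z zr; have := ler_nmB (k z + c) (k z - c).
  rewrite (_ : k z + c - (k z - c) = 2 * c); last by ring.
  by rewrite nmM nm2; lra.
have kc0 z : A z -> k z + c != 0.
  by move=> /far h; rewrite -nm_gt0; exact: lt_le_trans h.
pose g z := (d / 2)%:C%C * (k z + c)^-1.
exists (fun z => mob (g z0) (g z)); apply: fam_mob.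
- apply: holoM; first exact: holo_cst.
  by apply: holoV => //; apply: holoD => //; exact: holo_cst.
- move=> z Az; have h := far z Az; have h0 := lt_le_trans d0 h.
  rewrite /g nmM nmV nm_real gtr0_norm ?divr_gt0// ltr_pdivrMr// mul1r.
  by apply: lt_le_trans h; rewrite ltr_pdivrMr// ltr_pMr// ltr1n.
- move=> z w Az Aw; have d20 : (d / 2)%:C%C != 0 :> C.
    by rewrite -nm_gt0 nm_real gtr0_norm divr_gt0.
  move/(mulfI d20)/invr_inj/addIr => E.
  by apply: (@addIr _ (- a)); rewrite -!k2// E.
Qed.

(** With [b = k z0] one has [w = - b ^+ 2], and solving for [f] gives [(k ^+ 2 - b ^+ 2) / (1 -
    conjc b ^+ 2 * k ^+ 2)]. Numerator and denominator factor as differences of squares, so [f] is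
    the product of [mob b k], the competitor, and [mob (- b) k], of modulus below 1. *)
Lemma koebe f w : fam f -> nm w < 1 -> (forall z, A z -> f z != w) ->
  exists2 h, fam h & forall z, A z -> f z != 0 -> nm (f z) < nm (h z).
Proof.
move=> [hf f1 fi fz0] w1 fw.
have [||k hk k2] := holo_sqrt_exists (f := fun z => mob w (f z)) oA cA nA.
- exact: holo_mob.
- by move=> z Az; rewrite mob_eq0 ?fw// f1.
have k1 z : A z -> nm (k z) < 1.
  move=> Az; rewrite -(@ltr_pXn2r _ 2) ?nnegrE ?nm_ge0// expr1n -nmX k2//.
  by apply: mob_lt1 => //; exact: f1.
have ki : inj_on k.
  move=> z v Az Av /(congr1 (fun x => x ^+ 2)); rewrite k2// k2//.
  by move/mob_inj => H; apply: fi => //; apply: H => //; exact: f1.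
exists (fun z => mob (k z0) (k z)); first exact: fam_mob.
move=> z Az fz; set b := k z0.
have b2 : b ^+ 2 = - w by rewrite k2// fz0 /mob mulr0 subr0 sub0r divr1.
have b1 : nm b < 1 by exact: k1.
have wE : w = - b ^+ 2 by rewrite b2 opprK.
have cwE : conjc w = - conjc b ^+ 2 by rewrite wE rmorphN rmorphXn.
have e1 : f z * (1 - conjc b ^+ 2 * k z ^+ 2) = k z ^+ 2 - b ^+ 2.
  have := k2 z Az; rewrite /mob; have := mob_den w1 (f1 z Az) => d0.
  move/(congr1 ( *%R^~ (1 - conjc w * f z))); rewrite divfK// => E.
  have : f z = k z ^+ 2 * (1 - conjc w * f z) + w by rewrite E subrK.
  rewrite cwE wE => E'; rewrite mulrBr mulr1 {1}E'; ring.
have d1 : 1 - conjc b * k z != 0 by apply: mob_den => //; exact: k1.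
have nb1 : nm (- b) < 1 by rewrite nmN.
have d2 := mob_den nb1 (k1 z Az); rewrite rmorphN /= mulNr opprK in d2.
have fE : f z = mob b (k z) * mob (- b) (k z).
  rewrite /mob rmorphN /= mulNr !opprK mulf_div -subr_sqr -e1.
  rewrite (_ : (1 - conjc b * k z) * (1 + conjc b * k z) = 1 - conjc b ^+ 2 * k z ^+ 2).
    rewrite mulfK// (_ : 1 - _ = (1 - conjc b * k z) * (1 + conjc b * k z)).
      exact: mulf_neq0.
    by ring.
  by ring.
have := mob_lt1 nb1 (k1 z Az); rewrite fE nmM => m1.
rewrite gtr_pMr// nm_gt0; apply: contraNneq fz => E.
by rewrite fE E mul0r.
Qed.

Section Limit.
Variables (U : set_system nat) (F : nat -> C -> C) (f : C -> C) (z1 : C).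
Hypotheses (UU : UltraFilter U) (famF : forall i, fam (F i)).
Hypotheses (fl : forall z, A z -> clim U (F ^~ z) (f z)) (Az1 : A z1) (fz1 : f z1 != 0).

Let hF i : holo A (F i). Proof. by case: (famF i). Qed.
Let F1 i z : A z -> nm (F i z) <= 1. Proof. by case: (famF i) => _ h _ _ /h /ltW. Qed.

Lemma fam_limit_holo : holo A f.
Proof.
apply: limit_holo fl => // a /oA[r r0 rA]; exists r, 1; split => // i z /rA; exact: F1.
Qed.

Let fz0 : f z0 = 0.
Proof.
apply: (@clim_unique _ _ U _ (F ^~ z0)) (fl Az0) _.
apply: (@clim_near _ _ U _ (fun=> 0)); last exact: clim_cst.
by apply: nearW => i; case: (famF i).
Qed.

(* By [hurwitz] the set where [f] takes the value [u] is open. *)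
Let not_const (u : C) : (exists2 z, A z & f z = u) ->
  (forall z, A z -> f z = u -> exists r : R, [/\ 0 < r, cball z r `<=` A &
     exists v : nat -> C, [/\ forall i, nm (v i) <= 1,
       forall i w, cball z r w -> F i w != v i & clim U v u]]) -> False.
Proof.
move=> ex H; have K : forall z, A z -> f z = u.
  apply: cA => //.
  - move=> z Az fz; have [r [r0 rA [v [v1 Fv vl]]]] := H z Az fz.
    exists (r / 16) => [|w wr _]; first by rewrite divr_gt0.
    rewrite -fz; apply: (hurwitz UU r0 _ _ v1 Fv _ _ (ltW wr)).
    + by move=> i; exact: holo_sub rA (hF i).
    + by move=> i w' /rA; exact: F1.
    + by move=> w' /rA; exact: fl.
    + by rewrite fz.
  - move=> z Az fz; have n0 : 0 < nm (f z - u) by rewrite nm_gt0 subr_eq0; exact/eqP.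
    apply: filterS (holo_cont oA fam_limit_holo Az n0) => w + _ E.
    by rewrite E nmC ltxx.
by move/eqP: fz1; apply; rewrite (K z1 Az1) -(K z0 Az0).
Qed.

Lemma fam_limit : fam f.
Proof.
have f1 z : A z -> nm (f z) <= 1.
  by move=> Az; apply: clim_nm_le (fl Az) _; apply: nearW => i; exact: F1.
split => //.
- exact: fam_limit_holo.
- move=> z Az; rewrite lt_def f1// andbT; apply/eqP => E.
  (* Every [F i] omits the unimodular value [f z] throughout [A], so a constant sequence serves as
     [v]. *)
  apply: (@not_const (f z)); first by exists z.
  move=> w Aw _; have [r r0 rA] := oA Aw; exists r; split => //.
  exists (fun=> f z); split => [_|i v /rA Av|]; [by rewrite -E| |exact: clim_cst].
  apply/eqP => Ev; have [_ /(_ v Av) + _ _] := famF i.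
  by rewrite Ev -E ltxx.
- move=> a b Aa Ab Eab; apply/eqP/negPn/negP => ab.
  apply: (@not_const (f a)); first by exists a.
  move=> z Az fz.
  (* One of [a] and [b] differs from [z]; near [z] the injective [F i] omit their own values at that
     point, and these converge to [f a]. *)
  have [c [Ac cz fc]] : exists c, [/\ A c, c != z & f c = f a].
    by have [->|az] := eqVneq z a; [exists b; rewrite eq_sym|exists a; rewrite eq_sym].
  have n0 : 0 < nm (c - z) by rewrite nm_gt0 subr_eq0.
  have [r r0 Hr] := filterI (oA Az) (cn_ball z n0).
  exists r; split => // [v /Hr[]//|].
  exists (F ^~ c); split => [i|i v /Hr[Av vz]|]; first exact: F1.
    apply/eqP => E; have [_ _ /(_ v c Av Ac E) Evc _] := famF i.
    by move: vz; rewrite Evc ltxx.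
  by rewrite -fc; exact: fl.
Qed.

End Limit.

Theorem riemann_mapping_complex a : ~ A a -> (exists2 z, A z & z != z0) ->
  exists f, [/\ holo A f, forall z, A z -> nm (f z) < 1, inj_on f &
    forall w, nm w < 1 -> exists2 z, A z & f z = w].
Proof.
move=> nAa [z1 Az1 z10]; have [g0 famg0] := fam_nonempty nAa.
pose E := [set x : R | exists2 g, fam g & x = nm (g z1)].
have supE : has_sup E.
  split; first by exists (nm (g0 z1)), g0.
  by exists 1 => _ [g [_ g1 _ _] ->]; exact/ltW/g1.
have g0z1 : 0 < nm (g0 z1).
  have [_ _ gi gz0] := famg0; rewrite nm_gt0; apply: contraNneq z10 => h.
  by apply/eqP; apply: gi => //; rewrite gz0.
(* Positivity of the supremum is what keeps the limit from being constant. *)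
have s0 : 0 < sup E by apply: lt_le_trans g0z1 _; apply: sup_upper_bound => //; exists g0.
have /choice[F HF] : forall n : nat, exists g, fam g /\ sup E - n.+1%:R^-1 < nm (g z1).
  move=> n; have e0 : 0 < n.+1%:R^-1 :> R by rewrite invr_gt0.
  by have [_ [g fg ->] h] := sup_adherent e0 supE; exists g.
(* Since [U] refines the filter at infinity, a limit along it attains the supremum. *)
have [U [UU oU]] := @ultraFilterLemma _ (\oo : set_system nat) _.
have F1 i z : A z -> nm (F i z) <= 1 by case: (HF i) => -[_ h _ _] _ /h /ltW.
have /choice[f fl] : forall z, exists l, A z -> clim U (F ^~ z) l.
  move=> z; have [Az|] := pselect (A z); last by exists 0.
  by have [//|l Hl] := @ultra_clim R U (F ^~ z) 1 UU; [move=> n; exact: F1|exists l].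
have fs : sup E <= nm (f z1).
  apply/ler_addgt0Pr => e e0; have e2 : 0 < e / 2 by rewrite divr_gt0.
  have hU : U [set n | n.+1%:R^-1 < e / 2].
    by apply: oU; exact: near_infty_natSinv_lt (PosNum e2).
  have [n [h1 h2]] := filter_ex (filterI (fl z1 Az1 _ e2) hU).
  have [_ h3] := HF n; have := ler_nm_dist (F n z1) (f z1).
  have h4 : n.+1%:R^-1 < e / 2 := h2; have h5 : nm (F n z1 - f z1) < e / 2 := h1.
  by move: (n.+1%:R^-1) h3 h4 => x h3 h4; lra.
have fz1 : f z1 != 0 by rewrite -nm_gt0; exact: lt_le_trans fs.
have famf : fam f by apply: (@fam_limit U F f z1) => // i; case: (HF i).
have [hf f1 fi fz0] := famf.
exists f; split => // w w1; apply: contrapT => nw.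
have [z Az|h famh fh] := koebe famf w1.
  by apply/eqP => fz; apply: nw; exists z.
have : nm (h z1) <= sup E by apply: sup_upper_bound => //; exists h.
by have := fh z1 Az1 fz1; lra.
Qed.

End RiemannMapping.

(** * From R[i] to the plane *)

Section Plane.
Variable R : realType.
Local Notation C := R[i].
Local Notation P := 'rV[R]_2.
Implicit Types (x y h : P) (z w d : C).

Definition toC x : C := Complex (x ord0 0) (x ord0 1).
Definition ofC z : P := \row_j (if j == 0 then complex.Re z else complex.Im z).

Lemma ord2P (j : 'I_2) : j = 0 \/ j = 1.
Proof. by case: j => -[|[|//]] ?; [left|right]; exact: val_inj. Qed.

Lemma toCK : cancel toC ofC.
Proof.
by move=> x; apply/rowP => j; rewrite mxE /toC /=; case: (ord2P j) => ->.
Qed.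

Lemma ofCK : cancel ofC toC.
Proof. by case=> a b; rewrite /toC /ofC !mxE /=. Qed.

Lemma toCD x y : toC (x + y) = toC x + toC y.
Proof. by rewrite /toC !mxE. Qed.
Lemma toCB x y : toC (x - y) = toC x - toC y.
Proof. by rewrite /toC !mxE. Qed.
Lemma toC0 : toC 0 = 0.
Proof. by rewrite /toC !mxE. Qed.

Lemma enormE x : enorm x = nm (toC x).
Proof.
rewrite /enorm /nm /toC /= big_ord_recr big_ord_recr big_ord0 /= add0r.
by congr (Num.sqrt (x _ _ ^+ 2 + x _ _ ^+ 2)); exact: val_inj.
Qed.

Lemma norm_le_nm x : `|x| <= nm (toC x).
Proof.
have [->|x0] := eqVneq `|x| 0; first exact: nm_ge0.
have [[i j] /= E] := mx_norm_neq0 x0.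
have -> : `|x| = `|x i j| by [].
rewrite (ord1 i); case: (ord2P j) => ->.
  by apply: le_trans (ler_Re _).
by apply: le_trans (ler_Im _).
Qed.

Lemma entry_le_norm x j : `|x ord0 j| <= `|x|.
Proof.
rewrite /Num.norm /= mx_normrE.
exact: (le_bigmax _ (fun i : 'I_1 * 'I_2 => `|x i.1 i.2|) (ord0, j)).
Qed.

Lemma nm_le_norm x : nm (toC x) <= 2 * `|x|.
Proof.
apply: (le_trans (nm_leD _)); rewrite /toC /=.
have := entry_le_norm x 0; have := entry_le_norm x 1; lra.
Qed.

Lemma near_toC x (Q : C -> Prop) :
  cn (toC x) Q -> \forall y \near x, Q (toC y).
Proof.
case=> r r0 Hr; apply/nbhs_normP; exists (r / 2); first by rewrite /= divr_gt0.
move=> y /= xy; apply: Hr; rewrite nmC -toCB.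
by apply: le_lt_trans (nm_le_norm _) _; rewrite mulrC -ltr_pdivlMr.
Qed.

Lemma near_ofC z (Q : P -> Prop) :
  (\forall y \near ofC z, Q y) -> cn z (Q \o ofC).
Proof.
move=> /nbhs_normP[r /= r0 Hr]; exists r => // w wz; apply: Hr => /=.
by apply: le_lt_trans (norm_le_nm _) _; rewrite toCB !ofCK nmC.
Qed.

Lemma open_opn (A : set P) : open A -> opn (A \o ofC).
Proof. by rewrite openE => oA z Az; exact: near_ofC (oA _ Az). Qed.

Lemma opn_open (A : set C) : opn A -> open (A \o toC).
Proof. by move=> oA; rewrite openE => x Ax; exact: near_toC (oA _ Ax). Qed.

Lemma connected_cnn (A : set P) : open A -> connected A -> cnn (A \o ofC).
Proof.
move=> oA cA Q [z Az Qz] Qo Qc w Aw.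
suff E : A `&` (Q \o toC) = A.
  have [_ /=] : (A `&` (Q \o toC)) (ofC w) by rewrite E.
  by rewrite ofCK.
apply: cA.
- by exists (ofC z); split => //=; rewrite ofCK.
- exists (A `&` (Q \o toC)); last by rewrite setIA setIid.
  rewrite openE => x [Ax Qx]; rewrite /interior.
  have AA : (A \o ofC) (toC x) by rewrite /= toCK.
  have := near_toC (Qo _ AA Qx); move: oA; rewrite openE => /(_ x Ax).
  by apply: filterS2 => y Ay; rewrite /= toCK => /(_ Ay).
- exists (~` (A `&` (~` Q \o toC))).
    apply: open_closedC; rewrite openE => x [Ax Qx]; rewrite /interior.
    have AA : (A \o ofC) (toC x) by rewrite /= toCK.
    have := near_toC (Qc _ AA Qx); move: oA; rewrite openE => /(_ x Ax).
    by apply: filterS2 => y Ay; rewrite /= toCK => /(_ Ay).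
  apply/seteqP; split => x [Ax] /=; first by move=> Qx; split => // -[].
  by move=> n; split => //; apply: contrapT => Qx; apply: n.
Qed.

Lemma cnn_connected (A : set C) : cnn A -> connected (A \o toC).
Proof.
move=> cA B [x Bx] [V oV BV] [K cK BK].
have sub y : B y -> A (toC y) by rewrite BV => -[].
apply/seteqP; split => y; first exact: sub.
rewrite /= => Ay; rewrite -(toCK y); move: (toC y) Ay.
apply: (cA (B \o ofC)).
- by exists (toC x); [exact: sub|rewrite /= toCK].
- move=> z Az /=; rewrite BV => -[_ Vz].
  move: oV; rewrite openE => /(_ _ Vz) /near_ofC; apply: filterS => w /= Vw Aw.
  by split => //=; rewrite ofCK.
- move=> z Az /=; rewrite BK => nB.
  have Kz : ~ K (ofC z) by move=> Kz; apply: nB; split => //=; rewrite ofCK.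
  have : open (~` K) by exact: closed_openC.
  rewrite openE => /(_ _ Kz) /near_ofC; apply: filterS => w /= Kw Aw [_ ?].
  exact: Kw.
Qed.

(** The homotopy given on the square is made total by clamping both variables. *)
Lemma loops_contractible_null (A : set P) :
  loops_contractible R A -> loops_null (A \o ofC).
Proof.
move=> lA gm gc gA g01.
have [|||H [Hc HA H0 H1 Hs]] := lA (ofC \o gm).
- apply: continuous_subspaceT => t; apply/cvgrPdist_lt => e e0.
  apply: filterS (gc t e e0) => s h; apply: le_lt_trans (norm_le_nm _) _.
  by rewrite /= toCB !ofCK nmC.
- by move=> t _; exact: gA.
- by rewrite /= g01.
pose cc (p : R * R) : R * R := (clamp p.1, clamp p.2).
have ccK p : (`[0, 1]%classic `*` `[0, 1]%classic) (cc p).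
  by split; rewrite /= in_itv /=; exact: clamp01.
have ccc : continuous cc.
  move=> p.
  have h1 : (fun q : R * R => clamp q.1) @ p --> clamp p.1.
    by apply: continuous_comp; [exact: cvg_fst|exact: clamp_continuous].
  have h2 : (fun q : R * R => clamp q.2) @ p --> clamp p.2.
    by apply: continuous_comp; [exact: cvg_snd|exact: clamp_continuous].
  exact: cvg_pair h1 h2.
have c1 (t : R) : 0 <= t <= 1 -> t \in `[0, 1] by rewrite in_itv.
have u0 : 0 <= (0 : R) <= 1 by rewrite lexx ler01.
have u1 : 0 <= (1 : R) <= 1 by rewrite lexx ler01.
exists (fun p => toC (H (cc p))); split.
- move=> p e e0; move/subspace_continuousP : Hc => /(_ _ (ccK p)) Hp.
  have : H @ within (`[0, 1]%classic `*` `[0, 1]%classic) (nbhs (cc p)) --> H (cc p) := Hp.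
  move/cvgrPdist_lt => /(_ (e / 2)); rewrite divr_gt0// => /(_ isT).
  move=> Hn; have Hq : nbhs p [set q | (`[0, 1]%classic `*` `[0, 1]%classic) (cc q) ->
    `|H (cc p) - H (cc q)| < e / 2] := ccc p _ Hn.
  apply: (@filterS _ (nbhs p) _ _ _ _ Hq) => q /(_ (ccK q)) h.
  rewrite nmC -toCB; apply: le_lt_trans (nm_le_norm _) _.
  by rewrite mulrC -ltr_pdivlMr.
- by move=> p; rewrite /= toCK; exact/HA/ccK.
- by move=> t t01; rewrite /cc /= !clamp_id// H0 ?c1//= ofCK.
- by move=> t t01; rewrite /cc /= !clamp_id// H1 ?c1//= ofCK.
- move=> s s01; rewrite /cc /= !clamp_id//.
  by have [-> ->] := Hs s (c1 s s01); rewrite /= ofCK.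
Qed.

Lemma unit_diskE : unit_disk R = cball 0 1 \o toC.
Proof. by apply/funext => x; rewrite /unit_disk /cball /= enormE subr0. Qed.

Lemma domain_unit_disk : domain (unit_disk R).
Proof.
rewrite unit_diskE; split.
- by exists 0; rewrite /cball /= toC0 subr0 nm0.
- by apply: opn_open; exact: opn_cball.
- by apply: cnn_connected; exact: cnn_cball.
Qed.

(** Multiplication by [d] as a matrix acting on row vectors from the right: its rows are [d] and [d]
    times the imaginary unit. *)
Definition mulC_mx d : 'M[R]_2 :=
  \matrix_(i, j) (ofC (d * (if i == 0 then 1 else 'i%C))) ord0 j.

Lemma toC_mulC_mx d h : toC (h *m mulC_mx d) = d * toC h.
Proof.
case: d => a b; rewrite /toC !mxE !big_ord_recr !big_ord0 /= !mxE /=.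
apply/eqP; rewrite eq_complex /=.
have -> : widen_ord (leqnSn 1) ord_max = 0 :> 'I_2 by exact: val_inj.
have -> : ord_max = 1 :> 'I_2 by exact: val_inj.
by apply/andP; split; apply/eqP; ring.
Qed.

Lemma is_cd_diff (f : C -> C) x d : is_cd f (toC x) d ->
  differentiable (ofC \o f \o toC) x /\ jacobian (ofC \o f \o toC) x = mulC_mx d.
Proof.
move=> /is_cdP fd; pose L : {linear P -> P} := mulmxr (mulC_mx d).
have Lc : continuous L.
  move=> y; apply/(@cvgrPdist_lt _ _ _ (nbhs y) (nbhs_filter y)) => e e0.
  have K0 : 0 < 1 + nm d by rewrite ltr_pwDl// nm_ge0.
  apply: filterS (near_toC (cn_ball (toC y) (divr_gt0 e0 K0))) => h.
  rewrite ltr_pdivlMr// => yh; apply: le_lt_trans (norm_le_nm _) _.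
  rewrite toCB !toC_mulC_mx -mulrBr nmM nmC; apply: le_lt_trans yh.
  by rewrite mulrC ler_wpM2l ?nm_ge0// lerDr.
have Lo (e : R) : 0 < e -> \forall h \near (0 : P),
    `|ofC (f (toC (h + x))) - (ofC (f (toC x)) + h *m mulC_mx d)| <= e * `|h|.
  move=> e0; have e2 : 0 < e / 2 by rewrite divr_gt0.
  have [r r0 Hr] := fd (e / 2) e2.
  have : \forall h \near (0 : P), nm (toC h) < r.
    by apply: (@near_toC 0 (fun w => nm w < r)); exists r => // w; rewrite toC0 subr0.
  apply: filterS => h hr; apply: le_trans (norm_le_nm _) _.
  rewrite !toCB !toCD !ofCK toC_mulC_mx.
  have := Hr (toC h + toC x); rewrite addrK => /(_ hr).
  rewrite opprD addrA => /le_trans; apply.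
  by have := nm_le_norm h; rewrite -(ler_pM2l e2); lra.
have D : 'd (ofC \o f \o toC) x = L :> (P -> P).
  by apply: diff_unique Lc _; apply/eqaddoP => e e0; exact: filterS (Lo e e0).
split.
  apply/diff_locallyP; rewrite D; split => //.
  by apply/eqaddoP => e e0; exact: filterS (Lo e e0).
apply/row_matrixP => i; rewrite !rowE /jacobian mul_rV_lin1.
by have -> : 'd (ofC \o f \o toC) x (delta_mx 0 i) = L (delta_mx 0 i) by rewrite D.
Qed.

(** Each entry is the real or imaginary part of [g] times a unimodular number, so it varies no more
    than [g]. *)
Lemma mulC_mx_continuous (g : C -> C) x : clim (cn (toC x)) g (g (toC x)) ->
  mulC_mx (g (toC y)) @[y --> x] --> mulC_mx (g (toC x)).
Proof.
move=> gc S /nbhs_ballP[e /= e0 Se].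
have : \forall y \near x, nm (g (toC y) - g (toC x)) < e.
  exact: (@near_toC x (fun w => nm (g w - g (toC x)) < e)) (gc e e0).
apply: filterS => y ye; apply: Se; split => // i j.
rewrite /ball /= !mxE; set u := (if i == 0 then _ else _).
have nu : nm u = 1.
  by rewrite /u; case: ifP; rewrite ?nm1// /nm /= expr0n expr1n add0r sqrtr1.
apply: le_lt_trans ye; rewrite nmC -[leRHS]mulr1 -nu -nmM mulrBl.
by case: ifP => _; [rewrite -Re_sub; exact: ler_Re|rewrite -Im_sub; exact: ler_Im].
Qed.

Lemma holo_conformal (A : set P) (f : C -> C) : domain A ->
  holo (A \o ofC) f -> (forall z, (A \o ofC) z -> nm (f z) < 1) ->
  inj_on (A \o ofC) f ->
  (forall w, nm w < 1 -> exists2 z, (A \o ofC) z & f z = w) ->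
  conformal A (unit_disk R) (ofC \o f \o toC).
Proof.
move=> dA hf f1 fi fs; have [_ oA _] := dA.
have oA' := open_opn oA; have [g fg hg] := holo_deriv oA' hf.
have At x : A x -> (A \o ofC) (toC x) by rewrite /= toCK.
split => //; first exact: domain_unit_disk.
- split.
  + by move=> x Ax; rewrite unit_diskE /cball /= ofCK subr0; exact/f1/At.
  + move=> x y /set_mem Ax /set_mem Ay /= /(can_inj ofCK) E.
    by apply: (can_inj toCK); apply: fi => //; exact: At.
  + move=> y; rewrite unit_diskE /cball /= subr0 => /fs[z Az fz].
    by exists (ofC z) => //=; rewrite ofCK fz toCK.
- move=> x Ax; split; first exact: (is_cd_diff (fg _ (At x Ax))).1.
  have J y : A y -> jacobian (ofC \o f \o toC) y = mulC_mx (g (toC y)).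
    by move=> /At/fg/is_cd_diff[].
  move=> S hS; have {}hS : nbhs (mulC_mx (g (toC x))) S by rewrite -J.
  have nA : \forall y \near x, A y by move: oA; rewrite openE; apply.
  apply: filterS2 nA (mulC_mx_continuous (holo_cont oA' hg (At x Ax)) hS) => y Ay.
  by rewrite /= -J.
(* The scale factor is the modulus of the complex derivative; the reverse triangle inequality turns
   the remainder of [f] into one for moduli. *)
- move=> x Ax; exists (nm (g (toC x))); apply/eqaddoP => e e0.
  have /is_cdP/(_ e e0)[r r0 Hr] := fg _ (At x Ax).
  have : \forall h \near (0 : P), nm (toC h) < r.
    by apply: (@near_toC 0 (fun w => nm w < r)); exists r => // w; rewrite toC0 subr0.
  apply: filterS => h hr; rewrite !fctE /= !enormE toCB !ofCK toCD.
  have := Hr (toC x + toC h); rewrite [toC x + _]addrC addrK => /(_ hr).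
  rewrite -nmM [`|nm (toC h)|]ger0_norm ?nm_ge0//.
  set a := f _ - f _; set b := g _ * _; move=> /(le_trans _); apply.
  have := ler_nm_dist a b; have := ler_nm_dist b a; rewrite (nmC b) ler_norml.
  by lra.
Qed.

End Plane.

Theorem theorem2 (R : realType) (Omega : set 'rV[R]_2)
    (Omega_sc : simply_connected_domain Omega)
    (Omega_neqT : Omega <> [set: 'rV[R]_2]) :
  exists phi : 'rV[R]_2 -> 'rV[R]_2, conformal Omega (unit_disk R) phi.
Proof.
have [dO lO] := Omega_sc; have [[x0 Ox0] oO cO] := dO.
have Az0 : (Omega \o @ofC R) (toC x0) by rewrite /= toCK.
have oA := open_opn oO.
have [a nAa] : exists a, ~ (Omega \o @ofC R) a.
  apply: contrapT => H; apply: Omega_neqT; apply/seteqP; split => // x _.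
  by apply: contrapT => nx; apply: H; exists (toC x); rewrite /= toCK.
(* The extremal problem needs a second point, found in a ball around the first. *)
have other : exists2 z, (Omega \o @ofC R) z & z != toC x0.
  have [r r0 Hr] := oA _ Az0; exists (toC x0 + (r / 2)%:C%C).
    apply: Hr; rewrite addrC addKr nm_real gtr0_norm ?divr_gt0//.
    by rewrite ltr_pdivrMr// ltr_pMr// ltr1n.
  rewrite -subr_eq0 addrC addKr -nm_gt0 nm_real gtr0_norm ?divr_gt0//.
have [f [hf f1 fi fs]] := riemann_mapping_complex oA (connected_cnn oO cO)
  (loops_contractible_null lO) Az0 nAa other.
by exists (@ofC R \o f \o @toC R); exact: holo_conformal.
Qed.
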